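(* For every integer $k\ge 0$, $|\mathcal{U}_{2k+1}(132,3412)|=\frac{1}{2k+1}\binom{3k}{k}$.
   Context: West's stack-sorting map $s$ is defined recursively on finite sequences of distinct positive integers: $s$ sends the empty sequence to itself, and if $\pi$ is a nonempty such sequence with largest entry $n$, writing $\pi=LnR$ one sets $s(\pi)=s(L)s(R)n$. A permutation $\pi\in S_n$ (one-line notation) is uniquely sorted if exactly one permutation $\sigma\in S_n$ satisfies $s(\sigma)=\pi$. Let $\mathcal{U}_n$ be the set of uniquely sorted permutations in $S_n$. A permutation $\pi$ contains a pattern $\tau\in S_m$ if some subsequence of $\pi$ of length $m$ has its entries in the same relative order as $\tau$; otherwise $\pi$ avoids $\tau$. $\mathcal{U}_{n}(\tau^{(1)},\dots,\tau^{(\ell)})$ denotes the set of permutations in $\mathcal{U}_n$ avoiding all of $\tau^{(1)},\dots,\tau^{(\ell)}$. *)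

(* Defs.v *)
From mathcomp Require Import all_boot all_order all_fingroup all_algebra.

Set Implicit Arguments.
Unset Strict Implicit.
Unset Printing Implicit Defensive.

Definition max_entry (w : seq nat) : nat := \max_(x <- w) x.

(* The first argument is recursion fuel; [stack_sort] supplies enough of it, and
   [stack_sort_nil], [stack_sort_cat] are the recursive definition of West's
   map, without fuel. *)
Fixpoint stack_sort_rec (fuel : nat) (w : seq nat) : seq nat :=
  match fuel, w with
  | fuel'.+1, _ :: _ =>
      let n := max_entry w in
      let i := index n w in
      stack_sort_rec fuel' (take i w) ++
      stack_sort_rec fuel' (drop i.+1 w) ++ [:: n]
  | _, _ => [::]
  end.

Definition stack_sort (w : seq nat) : seq nat := stack_sort_rec (size w) w.

Lemma stack_sort_rec_fuel (f g : nat) (w : seq nat) :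
  size w <= f -> size w <= g -> stack_sort_rec f w = stack_sort_rec g w.
Proof.
elim: f g w => [|f IHf] [|g] [|x w] //= Hf Hg.
set v := x :: w; set i := index (max_entry v) v.
have Hi : i < size v.
  rewrite index_mem /max_entry.
  have [j Hj] := eq_bigmax (fun j : 'I_(size v) => nth 0 v j)
                   (ltac:(by rewrite card_ord)).
  by rewrite (big_nth 0) big_mkord Hj mem_nth.
have Ht h : size w < h.+1 -> size (take i v) <= h.
  by move=> Hh; rewrite size_take Hi -ltnS (leq_trans Hi).
have Hd h : size w < h.+1 -> size (drop i w) <= h.
  by move=> Hh; rewrite size_drop; apply: leq_trans (leq_subr _ _) _.
by congr (_ ++ _ ++ _); apply: IHf; rewrite ?Ht ?Hd.
Qed.

Lemma stack_sort_nil : stack_sort [::] = [::].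
Proof. by []. Qed.

Lemma stack_sort_cat (L R : seq nat) (n : nat) :
  all (ltn^~ n) L -> all (ltn^~ n) R ->
  stack_sort (L ++ n :: R) = stack_sort L ++ stack_sort R ++ [:: n].
Proof.
move=> HL HR.
have Hmax : max_entry (L ++ n :: R) = n.
  rewrite /max_entry big_cat big_cons /=; apply/eqP.
  have Hle s : all (ltn^~ n) s -> \max_(x <- s) x <= n.
    move=> /allP Hs; apply/bigmax_leqP_seq => x xs _; exact/ltnW/Hs.
  by rewrite (maxn_idPl (Hle _ HR)) (maxn_idPr (Hle _ HL)).
have Hidx : index n (L ++ n :: R) = size L.
  rewrite index_cat /= eqxx addn0 ifN //.
  by apply/negP => /(allP HL); rewrite /= ltnn.
have Hdrop : drop (size L).+1 (L ++ n :: R) = R.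
  by rewrite -cat_rcons drop_size_cat ?size_rcons.
rewrite /stack_sort size_cat /= addnS.
have -> : forall f w, w != [::] -> stack_sort_rec f.+1 w =
    stack_sort_rec f (take (index (max_entry w) w) w) ++
    stack_sort_rec f (drop (index (max_entry w) w).+1 w) ++ [:: max_entry w].
- by move=> f [].
- rewrite Hmax Hidx take_size_cat // Hdrop.
  by congr (_ ++ _ ++ _); apply: stack_sort_rec_fuel; rewrite ?leq_addr ?leq_addl.
by case: (L).
Qed.

(* One-line notation with entries 1, ..., n. *)
Definition one_line (n : nat) (p : 'S_n) : seq nat :=
  [seq (val (p i)).+1 | i <- enum 'I_n].

Definition uniquely_sorted (n : nat) (p : 'S_n) : bool :=
  #|[set q : 'S_n | stack_sort (one_line q) == one_line p]| == 1.

Definition same_relative_order (u v : seq nat) : bool :=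
  (size u == size v) &&
  [forall i : 'I_(size u), forall j : 'I_(size u),
     (nth 0 u i < nth 0 u j) == (nth 0 v i < nth 0 v j)].

(* Subsequences of [w] are its maskings by bit vectors. *)
Definition contains_pattern (w tau : seq nat) : bool :=
  [exists b : (size w).-tuple bool, same_relative_order (mask b w) tau].

Definition avoids_pattern (w tau : seq nat) : bool := ~~ contains_pattern w tau.

Definition uniquely_sorted_avoiding (n : nat) (taus : seq (seq nat)) :
    {set 'S_n} :=
  [set p : 'S_n | uniquely_sorted p & all (avoids_pattern (one_line p)) taus].

(* Main.v *)
(* A uniquely sorted word is built recursively: it is a single letter or has the form
   u v n with u, v uniquely sorted, n its maximum and a descent between u and v (a "tight"
   word).  A tight word has exactly (length - 1)/2 descents, every sorted word of length l
   has at most (l - 1)/2, and no nonempty prefix of length l of a tight word has fewer than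
   (l - 1)/2; this makes the factorization u v n unique.

   If u v n avoids 132 and 3412, the entries of u form an interval of values, so u v n is
   given by u, v and the number s of entries of v below u.  The first entry of v is the
   right statistic: if u is a single letter, s may be anything at least that entry, and
   otherwise s equals it and the entries of v below it decrease (such v are counted by
   Catalan numbers).  With y marking the length minus the first entry, the generating
   function A(x, y) thus satisfies
     (1 - y) (A(y) - 1) = x y (A(1) - y A(y)) + (1 - y) x y (A(y) - 1) C(x y),
   C being the Catalan series.  The kernel method applies with y = T, T = 1 + x T^3: one
   has C(x T) = T, all terms in A(T) cancel, and A(1) = T remains.  The series are
   replaced by polynomials modulo x^N. *)
Require Import Defs.
From mathcomp Require Import all_boot all_order all_fingroup all_algebra.
From mathcomp Require Import zify ring.

Set Implicit Arguments.
Unset Strict Implicit.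
Unset Printing Implicit Defensive.

(** * Tight words and unique preimages *)

Inductive tight : seq nat -> Prop :=
| tight1 x : tight [:: x]
| tightN u v n : tight u -> tight v -> head 0 v < last 0 u ->
    all (ltn^~ n) u -> all (ltn^~ n) v -> tight (u ++ v ++ [:: n]).

(** The number of descents. The default [x] in [head x w'] keeps the last letter from being
    counted. *)
Fixpoint des (w : seq nat) : nat :=
  if w is x :: w' then (head x w' < x) + des w' else 0.

Lemma des_cat u v : u != [::] -> v != [::] ->
  des (u ++ v) = des u + des v + (head 0 v < last 0 u).
Proof.
case: v => [//|y v] + _; elim: u => [//|x u IHu] _ /=.
case: u IHu => [|z u] IHu /=; first by rewrite ltnn; lia.
by have /= -> := IHu isT; lia.
Qed.

Lemma tight_neq0 w : tight w -> w != [::].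
Proof. by case=> // u v n _ _ _ _ _; rewrite -size_eq0 !size_cat addnA addn1. Qed.

Lemma mem_last0 (w : seq nat) : w != [::] -> last 0 w \in w.
Proof. by case: w => [//|x w] _; apply: mem_last. Qed.

Lemma mem_head0 (w : seq nat) : w != [::] -> head 0 w \in w.
Proof. by case: w => [//|x w] _; apply: mem_head. Qed.

Lemma head_cat (u v : seq nat) : u != [::] -> head 0 (u ++ v) = head 0 u.
Proof. by case: u. Qed.

Lemma last_cat0 (u v : seq nat) : v != [::] -> last 0 (u ++ v) = last 0 v.
Proof. by case: v => [//|x v] _; rewrite last_cat. Qed.

Lemma des_rcons_max w n : all (ltn^~ n) w -> des (w ++ [:: n]) = des w.
Proof.
move=> /allP wn; have [->|w0] := eqVneq w [::]; first by rewrite /= ltnn.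
rewrite des_cat //= ltnn [n < _]ltnNge ltnW ?addn0 //.
by have /= := wn _ (mem_last0 w0).
Qed.

(** Each use of [tightN] adds the descent at the junction and the letter [n]: (2a + 1) + (2b + 1) +
    1 = 2(a + b + 1) + 1. *)
Lemma tight_size w : tight w -> size w = (des w).*2.+1.
Proof.
elim=> [x|u v n tu IHu tv IHv uv un vn]; first by rewrite /= ltnn.
rewrite catA des_rcons_max ?all_cat ?un // des_cat ?tight_neq0 // uv !size_cat /=.
lia.
Qed.

(** A prefix ending inside [v] is [u] followed by a prefix [r] of [v]; the junction descent pays for
    adding the bounds of [u] and [r], with one to spare. *)
Lemma tight_prefix p q : tight (p ++ q) -> p != [::] -> size p <= (des p).*2.+1.
Proof.
move=> t; move: {-2}(p ++ q) t (erefl (p ++ q)) => w t.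
elim: t p q => [x|u v n tu IHu tv IHv uv un vn] p q E p0.
  by case: p p0 E => [//|y [|z p]] //=; rewrite ltnn.
have Ew : tight (u ++ v ++ [:: n]) by apply: tightN.
have -> : p = take (size p) (u ++ v ++ [:: n]) by rewrite -E take_size_cat.
rewrite take_cat; case: ltnP => [lt_pu|le_up].
  apply: (IHu _ (drop (size p) u)); first by rewrite cat_take_drop.
  by rewrite -size_eq0 size_take lt_pu size_eq0.
case: (posnP (size p - size u)) => [->|gt0].
  by rewrite take0 cats0 tight_size.
rewrite take_cat; case: ltnP => [lt_pv|le_vp].
  set r := take _ v; have r0 : r != [::] by rewrite -size_eq0 size_take lt_pv -lt0n.
  have := IHv r (drop (size p - size u) v); rewrite cat_take_drop => /(_ erefl r0) sr.
  have Eh : head 0 r = head 0 v.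
    by rewrite -[in RHS](cat_take_drop (size p - size u) v) head_cat.
  rewrite (des_cat (tight_neq0 tu) r0) Eh uv size_cat (tight_size tu); lia.
case: (size p - size u - size v) => [|m] /=.
  rewrite cats0 (des_cat (tight_neq0 tu) (tight_neq0 tv)) uv size_cat.
  by rewrite (tight_size tu) (tight_size tv); lia.
by rewrite (tight_size Ew).
Qed.

(** If [u' = u ++ t] with [t] nonempty, then [v = t ++ v'] with a descent at the junction. By
    [tight_size] for [v] and [v'], the length of [t] is 2 des(t) + 2, one more than [tight_prefix]
    allows. *)
Lemma tight_split_le u v u' v' : tight v -> tight v' -> head 0 v' < last 0 u' ->
  u ++ v = u' ++ v' -> size u <= size u' -> u = u'.
Proof.
move=> tv tv' uv' E le_uu'.
have Eu' : u' = u ++ take (size u' - size u) v.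
  have := congr1 (take (size u')) E.
  by rewrite [in RHS]take_size_cat // take_cat ltnNge le_uu'.
set t := take _ v in Eu'.
have [t0|t0] := eqVneq t [::]; first by rewrite Eu' t0 cats0.
have Ev : v = t ++ v'.
  by move: E; rewrite Eu' -catA => /eqP; rewrite eqseq_cat // eqxx => /eqP.
have := tight_size tv; rewrite {1 2}Ev (des_cat t0 (tight_neq0 tv')).
have -> : last 0 t = last 0 u' by rewrite Eu' last_cat0.
rewrite uv' size_cat (tight_size tv').
by rewrite Ev in tv; have := tight_prefix tv t0; lia.
Qed.

Lemma tight_split u v u' v' : tight v -> tight v' ->
  head 0 v < last 0 u -> head 0 v' < last 0 u' ->
  u ++ v = u' ++ v' -> u = u' /\ v = v'.
Proof.
move=> tv tv' uv uv' E; suff Eu : u = u'.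
  by split=> //; move: E; rewrite Eu => /eqP; rewrite eqseq_cat // eqxx => /eqP.
case/orP: (leq_total (size u) (size u')) => le_uu'.
  exact: (tight_split_le tv tv' uv' E le_uu').
by apply/esym/(tight_split_le tv' tv uv (esym E)).
Qed.

(** * Preimages under stack-sorting *)

Lemma uniq_split_max (w : seq nat) : uniq w -> w != [::] ->
  exists A n B, [/\ w = A ++ n :: B, all (ltn^~ n) A & all (ltn^~ n) B].
Proof.
move=> uw w0.
have [n nw nmax] : exists2 n, n \in w & forall x, x \in w -> x <= n.
  elim: w w0 {uw} => [//|x [|y w] IHw] _.
    by exists x; rewrite ?mem_head // => z; rewrite inE => /eqP->.
  have [//|n nw nmax] := IHw; have [le_xn|lt_nx] := leqP x n.
    exists n; first by rewrite inE nw orbT.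
    by move=> z; rewrite inE => /predU1P[->|/nmax].
  exists x; rewrite ?mem_head // => z; rewrite inE => /predU1P[->//|/nmax].
  by move=> /leq_trans; apply; apply: ltnW.
case/splitPr: nw uw nmax => A B uAB nmax; exists A, n, B.
move: uAB; rewrite cat_uniq /= negb_or => /and4P[_ /andP[nA _] nB _].
split=> //; apply/allP => x xA; rewrite /= ltn_neqAle nmax ?mem_cat ?inE ?xA ?orbT // andbT.
  by apply: contraNneq nA => <-.
by apply: contraNneq nB => <-.
Qed.

(** Induction along the recursion of [stack_sort], cutting at the maximum. *)
Lemma uniq_max_ind (P : seq nat -> Prop) : P [::] ->
  (forall A n B, all (ltn^~ n) A -> all (ltn^~ n) B -> uniq (A ++ n :: B) ->
     P A -> P B -> P (A ++ n :: B)) ->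
  forall w, uniq w -> P w.
Proof.
move=> P0 PS w; have [m] := ubnP (size w); elim: m w => // m IHm w.
have [->//|w0] := eqVneq w [::].
move=> sw uw; have [A [n [B [Ew An Bn]]]] := uniq_split_max uw w0; subst w.
move: (uw); rewrite cat_uniq /= => /and4P[uA _ _ uB].
by apply: PS => //; apply: IHm => //; move: sw; rewrite size_cat /=; lia.
Qed.

Lemma perm_stack_sort w : uniq w -> perm_eq (stack_sort w) w.
Proof.
elim/uniq_max_ind => // A n B An Bn _ pA pB.
rewrite stack_sort_cat // perm_cat // cats1 (perm_trans _ (_ : perm_eq (n :: stack_sort B) _)) //.
  by rewrite perm_rcons.
by rewrite perm_cons.
Qed.

Lemma stack_sort_uniq w : uniq w -> uniq (stack_sort w).
Proof. by move=> uw; rewrite (perm_uniq (perm_stack_sort uw)). Qed.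

Lemma stack_sort_neq0 w : uniq w -> w != [::] -> stack_sort w != [::].
Proof. by move=> uw; rewrite -!size_eq0 (perm_size (perm_stack_sort uw)). Qed.

Lemma all_stack_sort n w : uniq w -> all (ltn^~ n) (stack_sort w) = all (ltn^~ n) w.
Proof. by move=> uw; apply/perm_all/perm_stack_sort. Qed.



(** Cut at the maximum. If exactly one side is empty, the length grows without a new descent, so
    equality is lost. If both are nonempty, the bounds add up with room for one more descent, and
    equality forces it at the junction together with equality on both sides: this is [tightN]. *)
Lemma stack_sort_tight w : uniq w -> w != [::] ->
  (des (stack_sort w)).*2 < size w /\
  (size w = (des (stack_sort w)).*2.+1 -> tight (stack_sort w)).
Proof.
elim/uniq_max_ind => // A n B An Bn; rewrite cat_uniq /= => /and4P[uA _ _ uB] IHA IHB _.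
rewrite stack_sort_cat // catA des_rcons_max ?all_cat ?all_stack_sort ?An // -catA size_cat /= addnS.
have [A0|A0] := eqVneq A [::]; have [B0|B0] := eqVneq B [::].
- by subst; split => // _; apply: tight1.
- by subst A; have [] := IHB B0; rewrite /= => *; split; lia.
- by subst B; rewrite cats0; have [] := IHA A0; rewrite /= => *; split; lia.
have [sA tA] := IHA A0; have [sB tB] := IHB B0.
rewrite des_cat ?stack_sort_neq0 //; split; first by case: (head _ _ < _); lia.
case: (ltnP (head _ _)) => lt_BA sz; last by lia.
by apply: tightN; rewrite ?all_stack_sort //; [apply: tA|apply: tB]; lia.
Qed.

(** Preimages range over all words of distinct letters; by [perm_stack_sort] they are rearrangements
    of [w]. *)
Definition unique_preimage w := exists2 x, uniq x /\ stack_sort x = w &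
  forall y, uniq y -> stack_sort y = w -> y = x.

Lemma cat_cons_inj (n : nat) A B A' B' : n \notin A -> n \notin A' ->
  A ++ n :: B = A' ++ n :: B' -> A = A' /\ B = B'.
Proof.
elim: A A' => [|a A IHA] [|a' A'] //=.
- by move=> _ _ [->].
- by move=> _ + [E _]; rewrite inE E eqxx.
- by move=> + _ [E _]; rewrite inE E eqxx.
rewrite !inE !negb_or => /andP[_ nA] /andP[_ nA'] [-> E].
by have [-> ->] := IHA _ nA nA' E.
Qed.

Lemma max_notin (n : nat) w : all (ltn^~ n) w -> n \notin w.
Proof. by move=> /allP wn; apply/negP => /wn /=; rewrite ltnn. Qed.

(** Any preimage has the form [A' ++ n :: B'], where the images of [A'] and [B'] concatenate to
    [u ++ v]. Counting descents shows that this is again a tight cut, so [tight_split] identifies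
    the images with [u] and [v]. *)
Lemma tight_unique_preimage w : uniq w -> tight w -> unique_preimage w.
Proof.
move=> + t; elim: t => [n _|u v n tu IHu tv IHv uv un vn uw].
  exists [:: n] => [|y uy Ey]; first by rewrite (@stack_sort_cat [::] [::] n).
  by apply: perm_small_eq => //; rewrite perm_sym -Ey perm_stack_sort.
move: (uw); rewrite !cat_uniq /= => /and4P[uu _ uv' _].
have {IHu} [A [uA EA] unA] := IHu uu.
have {IHv} [B [uB EB] unB] := IHv uv'.
have pA : perm_eq u A by rewrite -EA perm_stack_sort.
have pB : perm_eq v B by rewrite -EB perm_stack_sort.
have An : all (ltn^~ n) A by rewrite -(perm_all _ pA).
have Bn : all (ltn^~ n) B by rewrite -(perm_all _ pB).
exists (A ++ n :: B) => [|y uy Ey].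
  split; last by rewrite stack_sort_cat // EA EB.
  rewrite -(perm_uniq (_ : perm_eq (u ++ v ++ [:: n]) _)) //.
  by rewrite perm_cat // cats1 perm_rcons perm_cons.
have y0 : y != [::].
  by apply/eqP => y0; move: (congr1 size Ey); rewrite y0 /= !size_cat /=; lia.
have [A' [m [B' [Ey' A'm B'm]]]] := uniq_split_max uy y0; subst y.
move: (uy); rewrite cat_uniq /= => /and4P[uA' _ _ uB'].
move: Ey; rewrite stack_sort_cat // !catA !cats1 => /rcons_inj[E Em]; subst m.
have Edes := congr1 des E.
have Esz := congr1 size E.
move: Edes Esz; rewrite [des (u ++ v)]des_cat ?tight_neq0 // uv !size_cat.
rewrite (tight_size tu) (tight_size tv).
rewrite !(perm_size (perm_stack_sort _)) //.
(* The length of [u ++ v] is exactly twice its number of descents, which [stack_sort_tight] forbids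
   for the image of one nonempty word. *)
have [A0|A0] := eqVneq A' [::].
  have [B0|B0] := eqVneq B' [::]; first by rewrite A0 B0.
  have [+ _] := stack_sort_tight uB' B0; rewrite A0 [stack_sort [::]]/= !cat0s.
  by clear; lia.
have [B0|B0] := eqVneq B' [::].
  have [+ _] := stack_sort_tight uA' A0; rewrite B0 [stack_sort [::]]/= !cats0.
  by clear; lia.
rewrite des_cat ?stack_sort_neq0 //.
have [sA tA] := stack_sort_tight uA' A0; have [sB tB] := stack_sort_tight uB' B0.
(* Without a descent at this junction, one half would need too many descents; with it, both halves
   attain the bound of [stack_sort_tight]. *)
case: (ltnP (head 0 _)) => [lt|_]; last by move: sA sB; clear; lia.
move=> Ed Es.
have [|Eu Ev] := tight_split _ tv lt uv E.
  by apply: tB; move: Ed Es sA sB; clear; lia.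
by rewrite (unA A') // (unB B').
Qed.

Lemma last_stack_sort w x : uniq w -> x \in w -> x <= last 0 (stack_sort w).
Proof.
move=> uw xw; have w0 : w != [::] by case: (w) xw.
have [A [n [B [Ew /allP An /allP Bn]]]] := uniq_split_max uw w0; subst w.
rewrite stack_sort_cat ?(introT allP) // catA cats1 last_rcons.
move: xw; rewrite mem_cat inE => /or3P[/An/ltnW|/eqP->|/Bn/ltnW] //.
Qed.

(** Induction on [v = p ++ q ++ [:: n]]: if [x] is a preimage of [stack_sort u ++ p] and [y] one of
    [q], then [x ++ n :: y] works. The letter [n] exceeds all of [u] because [stack_sort u] ends in
    its maximum and the junction is an ascent. *)
Lemma sorted_cat_tight u v : uniq (stack_sort u ++ v) -> uniq u -> tight v ->
  last 0 (stack_sort u) < head 0 v ->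
  exists2 x, uniq x & stack_sort x = stack_sort u ++ v.
Proof.
move=> uuv uu tv; elim: tv u uu uuv => [n|p q n tp IHp tq IHq pq pn qn] u uu uuv lt.
  have un : all (ltn^~ n) u.
    by apply/allP => x /(last_stack_sort uu) /leq_ltn_trans; apply.
  exists (u ++ [:: n]); last by rewrite stack_sort_cat.
  by rewrite cat_uniq /= uu orbF max_notin.
move: (uuv); rewrite cat_uniq => /and3P[_ _].
rewrite catA cat_uniq => /and3P[]; rewrite cat_uniq => /and3P[_ _ uq] _ _.
have uup : uniq (stack_sort u ++ p) by move: uuv; rewrite catA cat_uniq => /and3P[].
rewrite head_cat ?tight_neq0 // in lt.
have [x ux Ex] := IHp u uu uup lt.
have [y [uy Ey] _] := tight_unique_preimage uq tq.
have px : perm_eq (stack_sort u ++ p) x by rewrite -Ex perm_stack_sort.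
have py : perm_eq q y by rewrite -Ey perm_stack_sort.
have lt_pn : head 0 p < n by move/allP: pn; apply; rewrite mem_head0 ?tight_neq0.
have un : all (ltn^~ n) u.
  by apply/allP => z /(last_stack_sort uu) /leq_ltn_trans; apply; apply: ltn_trans lt_pn.
exists (x ++ n :: y); last first.
  rewrite stack_sort_cat ?Ex ?Ey -?catA // -?(perm_all _ px) -?(perm_all _ py) //.
  by rewrite all_cat pn all_stack_sort ?un.
rewrite -(perm_uniq (_ : perm_eq (stack_sort u ++ p ++ q ++ [:: n]) _)) //.
by rewrite catA perm_cat // cats1 perm_rcons perm_cons.
Qed.

(** Uniqueness passes to both factors, since replacing [A] or [B] by another preimage changes the
    whole preimage. An ascent between the factors would, by [sorted_cat_tight], yield a preimage of
    their concatenation, which [no_pre] excludes. *)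
Lemma unique_preimage_tight w : w != [::] -> unique_preimage w -> tight w.
Proof.
move=> w0 [x [ux Ex] unx]; subst w.
have {w0} x0 : x != [::] by apply: contraNneq w0 => ->.
move: x ux unx x0; apply: uniq_max_ind => // A n B An Bn uAB IHA IHB unx _.
move: (uAB); rewrite cat_uniq /= => /and4P[uA nAB nB uB].
rewrite stack_sort_cat //.
(* a preimage of the word without its maximum could be put on either side of the maximum *)
have no_pre t : uniq t -> t != [::] -> stack_sort t <> stack_sort A ++ stack_sort B.
  move=> ut t0 Et.
  have pt : perm_eq (stack_sort A ++ stack_sort B) t by rewrite -Et perm_stack_sort.
  have tn : all (ltn^~ n) t by rewrite -(perm_all _ pt) all_cat !all_stack_sort // An.
  have E1 : t ++ [:: n] = A ++ n :: B.
    apply: unx; first by rewrite cat_uniq /= ut orbF max_notin.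
    by rewrite !stack_sort_cat // Et /= catA.
  have E2 : [::] ++ n :: t = A ++ n :: B.
    apply: unx; first by rewrite /= ut max_notin.
    by rewrite !stack_sort_cat // Et /= catA.
  have := cat_cons_inj (max_notin tn) (max_notin An) E1.
  have := cat_cons_inj (isT : n \notin [::]) (max_notin An) E2.
  by case=> <- _ [t0']; rewrite t0' in t0.
have [A0|A0] := eqVneq A [::]; have [B0|B0] := eqVneq B [::].
- by subst; apply: tight1.
- by case: (no_pre B) => //; rewrite A0.
- by case: (no_pre A) => //; rewrite B0 cats0.
have tA : tight (stack_sort A).
  apply: IHA A0 => y uy Ey.
  have py : perm_eq y A by rewrite -(permPl (perm_stack_sort uy)) Ey perm_stack_sort.
  have yn : all (ltn^~ n) y by rewrite (perm_all _ py).
  suff /(cat_cons_inj (max_notin yn) (max_notin An))[] : y ++ n :: B = A ++ n :: B by [].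
  apply: unx; last by rewrite !stack_sort_cat // Ey.
  by rewrite (perm_uniq (_ : perm_eq _ (A ++ n :: B))) // perm_cat2r.
have tB : tight (stack_sort B).
  apply: IHB B0 => y uy Ey.
  have py : perm_eq y B by rewrite -(permPl (perm_stack_sort uy)) Ey perm_stack_sort.
  have yn : all (ltn^~ n) y by rewrite (perm_all _ py).
  suff /(cat_cons_inj (max_notin An) (max_notin An))[] : A ++ n :: y = A ++ n :: B by [].
  apply: unx; last by rewrite !stack_sort_cat // Ey.
  by rewrite (perm_uniq (_ : perm_eq _ (A ++ n :: B))) // perm_cat2l perm_cons.
have uAB' : uniq (stack_sort A ++ stack_sort B).
  have := stack_sort_uniq uAB; rewrite stack_sort_cat // catA cat_uniq.
  by case/andP.
apply: tightN; rewrite ?all_stack_sort //.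
rewrite ltnNge; apply/negP; rewrite leq_eqVlt => /predU1P[E|lt].
  move: uAB'; rewrite cat_uniq => /and3P[_ /hasPn/(_ (head 0 (stack_sort B))) + _].
  by rewrite mem_head0 ?tight_neq0 // => /(_ isT); rewrite -E mem_last0 ?tight_neq0.
have [x ux Ex] := sorted_cat_tight uAB' uA tB lt.
apply: (no_pre x ux _ Ex); apply/eqP => x0.
by move: Ex (tight_neq0 tA); rewrite x0 stack_sort_nil; case: (stack_sort A).
Qed.

(** * Patterns and one-line notation *)

Lemma contains_patternP w tau :
  reflect (exists2 s, subseq s w & same_relative_order s tau) (contains_pattern w tau).
Proof.
apply: (iffP existsP) => [[b sb]|[s /subseqP[m sm ->] sro]].
  by exists (mask b w) => //; apply: mask_subseq.
by exists (Tuple (introT eqP sm)).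
Qed.

Lemma same_relative_orderP u v : size u = size v ->
  reflect (forall i j, i < size u -> j < size u ->
             (nth 0 u i < nth 0 u j) = (nth 0 v i < nth 0 v j))
    (same_relative_order u v).
Proof.
move=> E; rewrite /same_relative_order E eqxx andTb -E.
apply: (iffP forallP) => [H i j ltiu ltju|H i].
  by have /forallP/(_ (Ordinal ltju))/eqP := H (Ordinal ltiu).
by apply/forallP => j; rewrite H.
Qed.

Definition av132 (w : seq nat) :=
  forall a b c, subseq [:: a; b; c] w -> a < c -> c < b -> False.

Definition av3412 (w : seq nat) :=
  forall a b c d, subseq [:: a; b; c; d] w -> c < d -> d < a -> a < b -> False.



Lemma avoids_132 w : avoids_pattern w [:: 1; 3; 2] <-> av132 w.
Proof.
rewrite /avoids_pattern; split=> [/contains_patternP H a b c sw ac cb|H].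
  case: H; exists [:: a; b; c] => //; apply/same_relative_orderP => //.
  by move=> [|[|[|//]]] [|[|[|//]]] _ _ /=; lia.
apply/contains_patternP => -[s sw sro].
have /andP[/eqP sz _] := sro; case: s sz sw sro => [|a [|b [|c []]]] //= _ sw.
move/(same_relative_orderP (erefl : size [:: a; b; c] = size [:: 1; 3; 2])) => sro.
by apply: (H a b c sw); [have := sro 0 2|have := sro 2 1]; move=> /= ->.
Qed.

Lemma avoids_3412 w : avoids_pattern w [:: 3; 4; 1; 2] <-> av3412 w.
Proof.
rewrite /avoids_pattern; split=> [/contains_patternP H a b c d sw cd da ab|H].
  case: H; exists [:: a; b; c; d] => //; apply/same_relative_orderP => //.
  by move=> [|[|[|[|//]]]] [|[|[|[|//]]]] _ _ /=; lia.
apply/contains_patternP => -[s sw sro].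
have /andP[/eqP sz _] := sro; case: s sz sw sro => [|a [|b [|c [|d []]]]] //= _ sw.
move/(same_relative_orderP (erefl : size [:: a; b; c; d] = size [:: 3; 4; 1; 2])) => sro.
by apply: (H a b c d sw); [have := sro 2 3|have := sro 3 0|have := sro 0 1]; move=> /= ->.
Qed.

Section OneLine.
Variable n : nat.
Implicit Type p : 'S_n.

Lemma size_one_line p : size (one_line p) = n.
Proof. by rewrite size_map size_enum_ord. Qed.

Lemma one_line_inj : injective (@one_line n).
Proof.
move=> p q /eq_in_map E; apply/permP => i; apply: val_inj.
by have := E i; rewrite mem_enum => /(_ isT) [].
Qed.

Lemma one_line_uniq p : uniq (one_line p).
Proof. by rewrite map_inj_uniq ?enum_uniq // => i j [/val_inj/perm_inj]. Qed.

Lemma one_line_perm p : perm_eq (one_line p) (iota 1 n).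
Proof.
apply: uniq_perm; rewrite ?one_line_uniq ?iota_uniq //.
apply: (uniq_min_size (one_line_uniq p) _ _).2 => [x /mapP[i _ ->]|].
  by rewrite mem_iota add1n !ltnS ltn_ord.
by rewrite size_one_line size_iota.
Qed.

Lemma one_line_surj w : perm_eq w (iota 1 n) -> exists p, one_line p = w.
Proof.
move=> pw; have sw : size w = n by rewrite (perm_size pw) size_iota.
have uw : uniq w by rewrite (perm_uniq pw) iota_uniq.
(* [one_line] raises ordinals by 1, so the permutation is read off from predecessors; [posw] makes
   this reversible. *)
have ltw (i : 'I_n) : (nth 0 w i).-1 < n.
  have : nth 0 w i \in iota 1 n by rewrite -(perm_mem pw) mem_nth ?sw.
  by rewrite mem_iota; lia.
have posw (i : 'I_n) : 0 < nth 0 w i.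
  have : nth 0 w i \in iota 1 n by rewrite -(perm_mem pw) mem_nth ?sw.
  by rewrite mem_iota; lia.
have inj : injective (fun i => Ordinal (ltw i)).
  move=> i j [] Eij; apply/val_inj/eqP; rewrite -(nth_uniq 0 _ _ uw) ?sw ?ltn_ord //.
  by rewrite -(prednK (posw i)) -(prednK (posw j)) Eij.
exists (perm inj); apply: (@eq_from_nth _ 0); first by rewrite size_one_line.
move=> i; rewrite size_one_line => lt_in.
rewrite (nth_map (Ordinal lt_in)) ?size_enum_ord // permE /=.
by rewrite prednK // (nth_ord_enum _ (Ordinal lt_in)).
Qed.

(** A preimage of [one_line p] is a rearrangement of 1, ..., [n], hence itself the one-line word of
    a permutation. The empty word is not tight, whence [0 < n]. *)
Lemma uniquely_sorted_tight p : 0 < n -> uniquely_sorted p <-> tight (one_line p).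
Proof.
move=> n0; have w0 : one_line p != [::] by rewrite -size_eq0 size_one_line -lt0n.
suff E : uniquely_sorted p <-> unique_preimage (one_line p).
  split=> [/E|t]; first exact: unique_preimage_tight.
  by apply/E; apply: tight_unique_preimage t; apply: one_line_uniq.
rewrite /uniquely_sorted; split=> [/cards1P[q Eq]|[x [ux Ex] unx]].
  exists (one_line q).
    by rewrite one_line_uniq; have := set11 q; rewrite -Eq inE => /eqP.
  move=> y uy Ey; have [r Er] : exists r : 'S_n, one_line r = y.
    by apply: one_line_surj; rewrite -(permPl (perm_stack_sort uy)) Ey one_line_perm.
  suff : r \in [set q] by rewrite inE -Er => /eqP->.
  by rewrite -Eq inE Er Ey.
have [r Er] : exists r : 'S_n, one_line r = x.
  by apply: one_line_surj; rewrite -(permPl (perm_stack_sort ux)) Ex one_line_perm.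
apply/cards1P; exists r; apply/setP => q; rewrite !inE; apply/eqP/eqP => [Eq|->].
  by apply: one_line_inj; rewrite Er; apply: unx; rewrite ?one_line_uniq.
by rewrite Er Ex.
Qed.
End OneLine.

(** * Gluing words avoiding 132 and 3412 *)

Implicit Types (t u v w : seq nat) (a b c d n s x y : nat).
Lemma subseq_cat_split (t u v : seq nat) : subseq t (u ++ v) ->
  exists2 i, i <= size t & subseq (take i t) u /\ subseq (drop i t) v.
Proof.
elim: u t => [|x u IHu] t /= s; first by exists 0; rewrite ?take0 ?drop0.
case: t s => [|y t] /=; first by exists 0; rewrite ?sub0seq.
case: (eqVneq y x) => [->|yx] /IHu[i le_i [s1 s2]].
  by exists i.+1 => //=; rewrite eqxx.
case: i le_i s1 s2 => [|i] le_i s1 s2; first by exists 0.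
by exists i.+1 => //=; rewrite (negbTE yx).
Qed.

Lemma subseq_map_inv (f : nat -> nat) t w : subseq t (map f w) ->
  exists2 t', subseq t' w & t = map f t'.
Proof.
case/subseqP => m _ ->; exists (mask m w); first exact: mask_subseq.
by rewrite map_mask.
Qed.

Lemma av132_map (f : nat -> nat) w : {mono f : x y / x < y} ->
  av132 (map f w) <-> av132 w.
Proof.
move=> fm; split=> [H a b c sw ac cb|H a b c /subseq_map_inv[[|a' [|b' [|c' []]]] // sw [-> -> ->]]].
  by apply: (H (f a) (f b) (f c)); rewrite ?fm //; apply: (map_subseq f sw).
by rewrite !fm; apply: H sw.
Qed.

Lemma av3412_map (f : nat -> nat) w : {mono f : x y / x < y} ->
  av3412 (map f w) <-> av3412 w.
Proof.
move=> fm; split=> [H a b c d sw cd da ab|H a b c d].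
  by apply: (H (f a) (f b) (f c) (f d)); rewrite ?fm //; apply: (map_subseq f sw).
move=> /subseq_map_inv[[|a' [|b' [|c' [|d' []]]]] // sw [-> -> -> ->]].
by rewrite !fm; apply: H sw.
Qed.

Lemma av132_subseq u w : subseq u w -> av132 w -> av132 u.
Proof. by move=> su H a b c s; apply: H (subseq_trans s su). Qed.

Lemma av3412_subseq u w : subseq u w -> av3412 w -> av3412 u.
Proof. by move=> su H a b c d s; apply: H (subseq_trans s su). Qed.

(** Neither 132 nor 3412 ends in its largest letter, so a final maximum takes part in no
    occurrence. *)
Lemma av132_rcons_max w n : all (ltn^~ n) w -> av132 w -> av132 (w ++ [:: n]).
Proof.
move=> /allP wn H a b c sw ac cb.
have [i] := subseq_cat_split sw.
move=> le_i [s1 s2].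
have b_n : b <= n.
  have : b \in w ++ [:: n] by apply: (mem_subseq sw); rewrite !inE eqxx orbT.
  by rewrite mem_cat inE => /orP[/wn/ltnW|/eqP->].
have [i3|i3] : i = 3 \/ i < 3 by move: le_i => /=; clear; lia.
  by move: s1; rewrite i3 => /H; apply.
have : c \in [:: n].
  apply: (mem_subseq s2); case: i i3 {le_i s1 s2} => [|[|[|]]] //= _; by rewrite ?inE ?eqxx ?orbT.
by rewrite inE => /eqP cn; move: cb; rewrite cn ltnNge b_n.
Qed.

Lemma av3412_rcons_max w n : all (ltn^~ n) w -> av3412 w -> av3412 (w ++ [:: n]).
Proof.
move=> /allP wn H a b c d sw cd da ab.
have [i] := subseq_cat_split sw.
move=> le_i [s1 s2].
have a_n : a <= n.
  have : a \in w ++ [:: n] by apply: (mem_subseq sw); rewrite !inE eqxx.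
  by rewrite mem_cat inE => /orP[/wn/ltnW|/eqP->].
have [i4|i4] : i = 4 \/ i < 4 by move: le_i => /=; clear; lia.
  by move: s1; rewrite i4 => /H; apply.
have : d \in [:: n].
  apply: (mem_subseq s2); case: i i4 {le_i s1 s2} => [|[|[|[|]]]] //= _; by rewrite ?inE ?eqxx ?orbT.
by rewrite inE => /eqP dn; move: da; rewrite dn ltnNge a_n.
Qed.

Lemma head_map0 (f : nat -> nat) w : w != [::] -> head 0 (map f w) = f (head 0 w).
Proof. by case: w. Qed.

Lemma last_map0 (f : nat -> nat) w : w != [::] -> last 0 (map f w) = f (last 0 w).
Proof. by case: w => // x w _ /=; rewrite last_map. Qed.

Lemma tight_map (f : nat -> nat) w : {in w &, {mono f : x y / x < y}} ->
  tight w -> tight (map f w).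
Proof.
move=> + t; elim: t => [x _|u v n tu IHu tv IHv uv /allP un /allP vn fm].
  exact: tight1.
have inu x : x \in u -> x \in u ++ v ++ [:: n] by rewrite mem_cat => ->.
have inv x : x \in v -> x \in u ++ v ++ [:: n] by rewrite !mem_cat => ->; rewrite orbT.
have inn : n \in u ++ v ++ [:: n] by rewrite !mem_cat inE eqxx !orbT.
rewrite !map_cat /=; apply: tightN.
- by apply: IHu => x y /inu xu /inu yu; apply: fm.
- by apply: IHv => x y /inv xu /inv yu; apply: fm.
- have [u0 v0] := (tight_neq0 tu, tight_neq0 tv).
  by rewrite head_map0 // last_map0 // fm ?(inv _ (mem_head0 v0)) ?(inu _ (mem_last0 u0)).
- by rewrite all_map; apply/allP => x xu /=; rewrite fm ?(inu _ xu) //; apply: un.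
- by rewrite all_map; apply/allP => x xv /=; rewrite fm ?(inv _ xv) //; apply: vn.
Qed.

Lemma last_tight w x : tight w -> x \in w -> x <= last 0 w.
Proof.
case=> [y|u v n _ _ _ /allP un /allP vn]; first by rewrite inE => /eqP->.
rewrite !mem_cat inE !last_cat /= => /or3P[/un/ltnW|/vn/ltnW|/eqP->] //.
Qed.

(** * The factorization of tight words avoiding 132 and 3412 *)

Definition ok w := [/\ perm_eq w (iota 1 (size w)), tight w, av132 w & av3412 w].

Lemma ok_mem w x : ok w -> (x \in w) = (0 < x <= size w).
Proof. by case=> /perm_mem-> _ _ _; rewrite mem_iota add1n ltnS. Qed.

Lemma ok_uniq w : ok w -> uniq w.
Proof. by case=> /perm_uniq-> _ _ _; rewrite iota_uniq. Qed.

Lemma ok_neq0 w : ok w -> w != [::].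
Proof. by case=> _ /tight_neq0. Qed.

(** An ascent among these letters would complete a 3412 with an ascent of larger letters placed in
    front. *)
Definition decbelow s (w : seq nat) := pairwise gtn [seq x <- w | x <= s].

Lemma pairwise_subseqP (r : rel nat) w :
  reflect (forall a b, subseq [:: a; b] w -> r a b) (pairwise r w).
Proof.
apply: (iffP idP) => [pw a b /subseq_pairwise/(_ pw)|].
  by rewrite /= !andbT.
elim: w => //= x w IHw H; rewrite IHw ?andbT => [|a b s].
  by apply/allP => y yw; apply: H; rewrite eqxx sub1seq.
apply: H; case: eqP => // _; rewrite sub1seq.
by apply: (mem_subseq s); rewrite !inE eqxx orbT.
Qed.

Lemma decbelowP s w :
  reflect (forall a b, subseq [:: a; b] w -> a <= s -> b <= s -> b < a) (decbelow s w).
Proof.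
apply: (iffP (pairwise_subseqP _ _)) => H a b; rewrite ?subseq_filter.
  by move=> sw sa sb; apply: H; rewrite subseq_filter /= sa sb.
by case/andP => /= /and3P[sa sb _] sw; apply: H.
Qed.

Lemma subseq_cons_head (t : seq nat) w : head 0 w \notin t -> subseq t w -> t != [::] ->
  subseq (head 0 w :: t) w.
Proof.
case: t w => [|y t] [|x w] //=.
by rewrite eqxx inE negb_or eq_sym => /andP[/negbTE-> _].
Qed.

(** If [b < a], then the first letter of [w], which is at most [s], forms a 132 with [a] and [b]. *)
Lemma increasing_above w s a b : uniq w -> av132 w -> head 0 w <= s ->
  subseq [:: a; b] w -> s < a -> s < b -> a < b.
Proof.
move=> uw aw hs sw sa sb; have nab : a != b.
  by have := subseq_uniq sw uw; rewrite /= inE andbT.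
rewrite ltn_neqAle nab leqNgt /=; apply/negP => lt_ba.
have := aw _ _ _ (subseq_cons_head _ sw isT); rewrite !inE negb_or.
by apply=> //; move: hs sa sb; clear; lia.
Qed.

(** Suppose [b < c] and let [h] be the first letter. If [h < c], then [h], [a], [c] is a 132; if
    [c < h], then [h], [a], [b], [c] is a 3412; and [h = c] would repeat a letter. *)
Lemma decreasing_after w s a b c : uniq w -> av132 w -> av3412 w -> head 0 w <= s ->
  subseq [:: a; b; c] w -> s < a -> b <= s -> c <= s -> c < b.
Proof.
move=> uw aw aw' hs sw sa sb sc.
have : uniq [:: a; b; c] := subseq_uniq sw uw.
rewrite /= !inE negb_or andbT => /andP[/andP[ab ac] bc].
rewrite ltn_neqAle eq_sym bc leqNgt /=; apply/negP => lt_bc.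
have sw2 : subseq [:: a; c] w.
  by apply: subseq_trans sw; rewrite /= eqxx; case: ifP => //=; rewrite eqxx.
have [hc|ch|E] := ltngtP (head 0 w) c.
- have := aw _ _ _ (subseq_cons_head _ sw2 isT); rewrite !inE negb_or.
  by apply=> //; move: hs sa sb sc hc; clear; lia.
- have := aw' _ _ _ _ (subseq_cons_head _ sw isT); rewrite !inE !negb_or.
  by apply=> //; move: hs sa sb sc ch lt_bc; clear; lia.
have w0 : w != [::] by case: (w) sw.
case: w E uw w0 sw {aw aw' hs sw2} => //= x w -> /andP[cw _] _.
case: eqP => [E|_] sw; first by rewrite E eqxx in ac.
by move: cw; rewrite (mem_subseq sw) // !inE eqxx !orbT.
Qed.

(* The word [build u v s] inserts the values of [u] between the values [s] and [s + 1] of [v]. *)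
Definition shift s m x := if x <= s then x else x + m.

Definition build u v s : seq nat :=
  map (addn s) u ++ map (shift s (size u)) v ++ [:: (size u + size v).+1].

Lemma shift_mono s m : {mono shift s m : x y / x < y}.
Proof. by move=> x y; rewrite /shift; case: (leqP x s); case: (leqP y s); lia. Qed.

Lemma addn_mono s : {mono addn s : x y / x < y}.
Proof. by move=> x y; rewrite ltn_add2l. Qed.

Lemma size_build u v s : size (build u v s) = (size u + size v).+1.
Proof. by rewrite !size_cat !size_map addnA addn1. Qed.

Lemma head_build u v s : u != [::] -> head 0 (build u v s) = s + head 0 u.
Proof. by case: u. Qed.

(** The bound [head 0 v <= s] produces the descent between the factors. A [u] with more than one
    letter contains an ascent, which is the reason for [decbelow]. *)
Definition glueable u v s := [/\ ok u, ok v, head 0 v <= s <= size v &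
  1 < size u -> decbelow s v].

Lemma iota_shift s m n : s <= n ->
  map (shift s m) (iota 1 n) = iota 1 s ++ iota (s + m).+1 (n - s).
Proof.
move=> sn; rewrite -{1}(subnKC sn) iotaD map_cat; congr (_ ++ _).
  by apply: map_id_in => x; rewrite mem_iota /shift; case: (leqP x s) => //; lia.
rewrite add1n (_ : (s + m).+1 = m + s.+1); last by lia.
rewrite iotaDl; apply/eq_in_map => x.
by rewrite mem_iota /shift; case: (leqP x s) => //; lia.
Qed.

Lemma perm_build u v s : perm_eq u (iota 1 (size u)) -> perm_eq v (iota 1 (size v)) ->
  s <= size v -> perm_eq (build u v s) (iota 1 (size (build u v s))).
Proof.
move=> pu pv sv; rewrite size_build -[(_ + _).+1]addn1 iotaD /build catA perm_cat2r.
have -> : size u + size v = s + (size u + (size v - s)) by lia.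
rewrite 2!iotaD !add1n perm_catC (perm_trans (perm_cat (perm_map _ pv) (perm_map _ pu))) //.
rewrite iota_shift // -catA perm_cat2l perm_catC perm_cat //.
  by rewrite -iotaDl addn1.
Qed.

(** The letters of [U] form an interval of values, so no letter of [V] lies between two of them. An
    occurrence of a pattern is treated according to the number [i] of its letters in [U]. *)
Lemma build_ok u v s : glueable u v s -> ok (build u v s).
Proof.
case=> ou ov /andP[hs sv] dec.
have [pu tu au au'] := ou; have [pv tv av av'] := ov.
set U := map (addn s) u; set V := map (shift s (size u)) v.
set n := (size u + size v).+1.
have U_gt x : x \in U -> s < x <= s + size u.
  by case/mapP => y; rewrite (ok_mem _ ou) => yu ->; lia.
have V_small x : x \in V -> x <= s \/ s + size u < x.
  by case/mapP => y _ ->; rewrite /shift; case: (leqP y s); lia.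
have Un : all (ltn^~ n) U by apply/allP => x /U_gt; rewrite /n /= /ltn /=; lia.
have Vn : all (ltn^~ n) V.
  by apply/allP => x /mapP[y]; rewrite (ok_mem _ ov) /shift /n /= /ltn /= => yv ->; case: (leqP y s); lia.
have UVn : all (ltn^~ n) (U ++ V) by rewrite all_cat Un.
split; first exact: perm_build.
- apply: tightN => //; try by apply: tight_map => // x y _ _; rewrite (addn_mono, shift_mono).
  rewrite head_map0 ?last_map0 ?ok_neq0 // /shift hs.
  by have := mem_last0 (ok_neq0 ou); rewrite (ok_mem _ ou); lia.
- rewrite /build catA; apply: av132_rcons_max => // a b c sw ac cb.
  have [i le_i [s1 s2]] := subseq_cat_split sw.
  (* For [i = 1] the letters [b], [c] lie above [U], where [V] increases; for [i = 2] the letter [c]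
     would fall inside the interval. *)
  case: i le_i s1 s2 => [|[|[|[|//]]]] _ /= s1 s2.
  + by apply: (av132_map v (shift_mono s (size u))).2 s2 ac cb.
  + have /U_gt aU : a \in U by rewrite -sub1seq.
    have /V_small bV : b \in V by apply: (mem_subseq s2); rewrite mem_head.
    have /V_small cV : c \in V by apply: (mem_subseq s2); rewrite !inE eqxx orbT.
    have [[|b' [|c' []]] // s2' [Eb Ec]] := subseq_map_inv s2.
    have : b' < c'; last by rewrite -(shift_mono s (size u)) -Eb -Ec; move: ac cb aU bV cV; clear; lia.
    apply: (increasing_above (ok_uniq ov) av hs s2').
      by move: Eb ac cb aU bV cV; rewrite /shift; case: (leqP b' s) => //; clear; lia.
    by move: Ec ac cb aU bV cV; rewrite /shift; case: (leqP c' s) => //; clear; lia.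
  + have /U_gt aU : a \in U by apply: (mem_subseq s1); rewrite mem_head.
    have /U_gt bU : b \in U by apply: (mem_subseq s1); rewrite !inE eqxx orbT.
    have /V_small cV : c \in V by rewrite -sub1seq.
    by move: ac cb aU bU cV; clear; lia.
  + by apply: (av132_map u (addn_mono s)).2 s1 ac cb.
rewrite /build catA; apply: av3412_rcons_max => // a b c d sw cd da ab.
have [i le_i [s1 s2]] := subseq_cat_split sw.
(* For [i = 1] the letter [b] is above [U] and [c], [d] are below, so [decreasing_after] applies;
   for [i = 2] it is [decbelow]; for [i = 3] the letter [d] would fall inside the interval. *)
case: i le_i s1 s2 => [|[|[|[|[|//]]]]] _ /= s1 s2.
- by apply: (av3412_map v (shift_mono s (size u))).2 s2 cd da ab.
- have /U_gt aU : a \in U by rewrite -sub1seq.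
  have /V_small bV : b \in V by apply: (mem_subseq s2); rewrite mem_head.
  have /V_small cV : c \in V by apply: (mem_subseq s2); rewrite !inE eqxx orbT.
  have /V_small dV : d \in V by apply: (mem_subseq s2); rewrite !inE eqxx !orbT.
  have [[|b' [|c' [|d' []]]] // s2' [Eb Ec Ed]] := subseq_map_inv s2.
  have : d' < c'; last by rewrite -(shift_mono s (size u)) -Ed -Ec; move: cd da ab aU bV cV dV; clear; lia.
  apply: (decreasing_after (ok_uniq ov) av av' hs s2').
  + by move: Eb cd da ab aU bV cV dV; rewrite /shift; case: (leqP b' s) => //; clear; lia.
  + by move: Ec cd da ab aU bV cV dV; rewrite /shift; case: (leqP c' s) => //; clear; lia.
  + by move: Ed cd da ab aU bV cV dV; rewrite /shift; case: (leqP d' s) => //; clear; lia.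
- have /U_gt aU : a \in U by apply: (mem_subseq s1); rewrite mem_head.
  have /U_gt bU : b \in U by apply: (mem_subseq s1); rewrite !inE eqxx orbT.
  have /V_small cV : c \in V by apply: (mem_subseq s2); rewrite mem_head.
  have /V_small dV : d \in V by apply: (mem_subseq s2); rewrite !inE eqxx orbT.
  have u1 : 1 < size u.
    by have := size_subseq s1; rewrite size_map.
  have [[|c' [|d' []]] // s2' [Ec Ed]] := subseq_map_inv s2.
  have : d' < c'; last by rewrite -(shift_mono s (size u)) -Ed -Ec; move: cd da ab aU bU cV dV; clear; lia.
  apply: (decbelowP _ _ (dec u1) _ _ s2').
  + by move: Ec cd da ab aU bU cV dV; rewrite /shift; case: (leqP c' s) => //; clear; lia.
  + by move: Ed cd da ab aU bU cV dV; rewrite /shift; case: (leqP d' s) => //; clear; lia.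
- have /U_gt aU : a \in U by apply: (mem_subseq s1); rewrite mem_head.
  have /U_gt cU : c \in U by apply: (mem_subseq s1); rewrite !inE eqxx !orbT.
  have /V_small dV : d \in V by rewrite -sub1seq.
  by move: cd da aU cU dV; clear; lia.
by apply: (av3412_map u (addn_mono s)).2 s1 cd da ab.
Qed.

Lemma subseq_pair u x : uniq u -> x \in u -> x != last 0 u -> subseq [:: x; last 0 u] u.
Proof.
elim: u => // y u IHu /= /andP[yu uu]; rewrite inE => /predU1P[->|xu].
  case: u yu uu {IHu} => [|z u] yu uu; first by rewrite /= eqxx.
  have sz : subseq [:: last z u] (z :: u) by rewrite sub1seq mem_last.
  by move=> _; rewrite [last _ _]/= [subseq _ _]/= eqxx; apply: sz.
case: u IHu xu yu uu => // z u IHu xu yu uu; rewrite [last _ _]/= => nx.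
case: eqP => [xy|_]; first by rewrite -xy xu in yu.
exact: IHu.
Qed.

Lemma shift_inj s m : injective (shift s m).
Proof. by apply: incn_inj => x y; rewrite leqNgt shift_mono -leqNgt. Qed.

(** Avoiding 132 makes the first tight factor [U] an interval of values; avoiding 3412 then gives
    [decbelow]. Both factors are restandardised to [u] and [v]. *)
Lemma ok_build w : ok w -> 1 < size w ->
  exists u v s, glueable u v s /\ w = build u v s.
Proof.
move=> ow; have [pw tw aw aw'] := ow; have uw := ok_uniq ow; have mw x := ok_mem x ow.
case: tw pw aw aw' uw mw {ow} => // U V n tU tV ltVU Un Vn pw aw aw' uw mw _.
clear w; set w := U ++ V ++ [:: n] in pw aw aw' uw mw *.
have uU : uniq U by move: uw; rewrite /w cat_uniq => /and3P[].
have uV : uniq V by move: uw; rewrite /w !cat_uniq => /and4P[].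
have UV x : x \in U -> x \notin V.
  move=> xU; apply: contraL uw => xV; rewrite /w cat_uniq negb_and; apply/orP; right.
  by rewrite negb_and negbK; apply/orP; left; apply/hasP; exists x; rewrite // mem_cat xV.
have sU : subseq U w by apply: prefix_subseq.
have sV : subseq V w.
  by apply: subseq_trans (suffix_subseq U _); apply: prefix_subseq.
have sz : size w = (size U + size V).+1 by rewrite !size_cat addnA addn1.
have n_max x : x \in w -> x <= n.
  by rewrite !mem_cat inE => /or3P[/(allP Un)/ltnW|/(allP Vn)/ltnW|/eqP->].
have nw : n \in w by rewrite !mem_cat inE eqxx !orbT.
have n_sz : n = (size U + size V).+1.
  apply/eqP; rewrite eqn_leq -sz; have := nw; rewrite mw => /andP[n0 ->] /=.
  by apply: n_max; rewrite mw leqnn sz.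
set M := last 0 U; have MU : M \in U by apply/mem_last0/tight_neq0.
have [m mU m_min] : exists2 m, m \in U & forall x, x \in U -> m <= x.
  have exU : exists m, m \in U by exists M.
  by case: (ex_minnP exU) => m mU m_min; exists m.
have U_M x : x \in U -> x <= M by apply: last_tight.
(* The last letter [M] of [U] is its maximum, so a letter of [V] between [m] and [M] would complete
   a 132. *)
have gap x : x \in V -> x < m \/ M < x.
  move=> xV; case: (ltnP x m) => [|le_mx]; first by left.
  case: (ltnP M x) => [|le_xM]; first by right.
  have nm : x != m by apply: contraTneq xV => ->; apply: UV.
  have nM : x != M by apply: contraTneq xV => ->; apply: UV.
  case: (aw m M x).
  - rewrite (_ : [:: m; M; x] = [:: m; M] ++ [:: x]) // cat_subseq //.
      by apply: subseq_pair => //; rewrite -/M; move: nm nM le_mx le_xM; clear; lia.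
    by rewrite sub1seq mem_cat xV.
  - by move: nm le_mx; clear; lia.
  - by move: nM le_xM; clear; lia.
have m0 : 0 < m by have := mem_subseq sU mU; rewrite mw => /andP[].
have Mn : M < n by apply: (allP Un).
have U_mem x : (x \in U) = (m <= x <= M).
  apply/idP/andP => [xU|[mx xM]]; first by rewrite m_min ?U_M.
  have : x \in w by rewrite mw sz -n_sz; move: m0 Mn mx xM; clear; lia.
  rewrite !mem_cat inE => /or3P[//|/gap|/eqP]; move: mx xM Mn; clear; lia.
have szU : size U = M - m.-1.
  rewrite -(size_iota m (M - m.-1)); apply/perm_size/uniq_perm; rewrite ?iota_uniq //.
  by move=> x; rewrite U_mem mem_iota; move: m0 (m_min _ MU); clear; lia.
(* All values below the minimum of [U] belong to [V], and there are [m - 1] of them. *)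
set s := m.-1.
have V_mem x : (x \in V) = (0 < x <= s) || (s + size U < x < n).
  apply/idP/idP => [xV|].
    have := allP Vn _ xV; have := gap _ xV; have := mem_subseq sV xV; rewrite mw szU /s /=.
    by move=> /andP[x0 _] H1 H2; move: H1 H2 x0 m0 (m_min _ MU); rewrite /ltn /=; clear; lia.
  move=> H; have : x \in w.
    by rewrite mw sz -n_sz; move: H (m_min _ MU) m0 Mn; rewrite szU /s; clear; lia.
  rewrite !mem_cat inE U_mem => /or3P[|//|/eqP];
  by move: H m0 (m_min _ MU) Mn; rewrite szU /s; clear; lia.
set u := map (subn^~ s) U.
(* The inverse of [shift s (size U)] on the letters of [V]. *)
set g := fun x => if x <= s then x else x - size U.
set v := map g V.
have Eu : map (addn s) u = U.
  rewrite -map_comp; apply: map_id_in => x; rewrite U_mem /s /=.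
  by move: m0; clear; lia.
have szu : size u = size U by rewrite size_map.
have szv : size v = size V by rewrite size_map.
have Ev : map (shift s (size u)) v = V.
  rewrite -map_comp; apply: map_id_in => x; rewrite V_mem /= /shift /g szu => Hx.
  case: (leqP x s) => xs; first by rewrite xs.
  by case: (leqP (x - size U) s); move: Hx xs; clear; lia.
have Ew : w = build u v s by rewrite /build Eu Ev szu szv -n_sz.
have tu : tight u.
  by apply: tight_map tU => x y; rewrite !U_mem /s /=; move: m0; clear; lia.
have tv : tight v.
  apply: tight_map tV => x y; rewrite !V_mem /g /=.
  by case: (leqP x s) => xs; case: (leqP y s) => ys; move: xs ys; clear; lia.
have au : av132 u by apply/(av132_map u (addn_mono s)); rewrite Eu; apply: av132_subseq aw.
have au' : av3412 u by apply/(av3412_map u (addn_mono s)); rewrite Eu; apply: av3412_subseq aw'.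
have av : av132 v.
  by apply/(av132_map v (shift_mono s (size u))); rewrite Ev; apply: av132_subseq aw.
have av' : av3412 v.
  by apply/(av3412_map v (shift_mono s (size u))); rewrite Ev; apply: av3412_subseq aw'.
have uu : uniq u by have := uU; rewrite -Eu map_inj_uniq //; apply: addnI.
have uv : uniq v by have := uV; rewrite -Ev map_inj_uniq //; apply: shift_inj.
have pu : perm_eq u (iota 1 (size u)).
  apply: uniq_perm => //; first exact: iota_uniq.
  move=> x; rewrite -(mem_map (@addnI s)) Eu U_mem mem_iota szu szU /s.
  by move: m0 (m_min _ MU); clear; lia.
have pv : perm_eq v (iota 1 (size v)).
  apply: uniq_perm => //; first exact: iota_uniq.
  move=> x; rewrite -(mem_map (@shift_inj s (size u))) Ev V_mem mem_iota szu szv /shift n_sz.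
  case: (leqP x s) => xs; last by move: xs; clear; lia.
  have : s <= size V by move: n_sz Mn (m_min _ MU) m0; rewrite szU /s; clear; lia.
  by move: xs; clear; lia.
exists u, v, s; split=> //; split=> //.
  apply/andP; split; last first.
    by rewrite szv; move: n_sz Mn (m_min _ MU) m0; rewrite szU /s; clear; lia.
  (* The junction descent puts the first letter of [V] below [M], hence by [gap] below [m]. *)
  have hV := mem_head0 (tight_neq0 tV); rewrite /v head_map0 ?tight_neq0 // /g.
  case: (leqP (head 0 V) s) => [->//|lt_s].
  by have := gap _ hV; move: ltVU lt_s m0; rewrite -/M /s; clear; lia.
(* Here [m] and [M] form an ascent of [U], so [c < d] would make [m], [M], [c], [d] a 3412. *)
move=> u1; apply/decbelowP => c d scd cs ds.
have nm : m != M.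
  by apply: contraTneq u1 => mM; rewrite szu szU mM; move: m0; rewrite mM; clear; lia.
have sU2 : subseq [:: m; M] U by apply: subseq_pair.
have sV2 : subseq [:: c; d] V.
  by rewrite -Ev (_ : [:: c; d] = map (shift s (size u)) [:: c; d]) ?map_subseq //= /shift cs ds.
have ncd : c != d by have := subseq_uniq scd uv; rewrite /= inE andbT.
rewrite ltn_neqAle eq_sym ncd leqNgt; apply/negP => lt_cd.
case: (aw' m M c d) => //.
- rewrite (_ : [:: m; M; c; d] = [:: m; M] ++ [:: c; d]) // cat_subseq //.
  by apply: subseq_trans sV2 (prefix_subseq _ _).
- by move: ds m0; rewrite /s; clear; lia.
by move: nm (m_min _ MU); clear; lia.
Qed.

Lemma ok_size_pos w : ok w -> 0 < size w.
Proof. by move=> ow; rewrite lt0n size_eq0 ok_neq0. Qed.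

(** The cut is unique by [tight_split], and [s] is recovered because [s + 1] is the least letter of
    the first factor. *)
Lemma build_inj u v s u' v' s' : glueable u v s -> glueable u' v' s' ->
  build u v s = build u' v' s' -> [/\ u = u', v = v' & s = s'].
Proof.
have split p q z : glueable p q z -> [/\ tight (map (addn z) p),
    tight (map (shift z (size p)) q) &
    head 0 (map (shift z (size p)) q) < last 0 (map (addn z) p)].
  case=> ox oy /andP[hz _] _; have [_ tx _ _] := ox; have [_ ty _ _] := oy; split.
  - by apply: tight_map => // a b _ _; rewrite addn_mono.
  - by apply: tight_map => // a b _ _; rewrite shift_mono.
  rewrite head_map0 ?last_map0 ?ok_neq0 // /shift hz.
  by have := mem_last0 (ok_neq0 ox); rewrite (ok_mem _ ox); move: hz; clear; lia.
move=> g g'; have [tu tv ltvu] := split _ _ _ g; have [tu' tv' ltvu'] := split _ _ _ g'.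
rewrite /build !catA !cats1 => /rcons_inj[E _].
have [Eu Ev] := tight_split tv tv' ltvu ltvu' E.
have [ou _ _ _] := g; have [ou' _ _ _] := g'.
have szu : size u = size u' by have := congr1 size Eu; rewrite !size_map.
have le z z' p p' : ok p -> ok p' -> map (addn z) p = map (addn z') p' -> z' <= z.
  move=> ox ox' Ex; have : z + 1 \in map (addn z') p'.
    by rewrite -Ex map_f // (ok_mem _ ox) ok_size_pos.
  by case/mapP => y; rewrite (ok_mem _ ox'); clear; lia.
have ss : s = s' by apply/eqP; rewrite eqn_leq (le _ _ _ _ ou ou' Eu) (le _ _ _ _ ou' ou (esym Eu)).
subst s'; rewrite szu in Ev.
by split=> //; [apply: inj_map Eu; apply: addnI | apply: inj_map Ev; apply: shift_inj].
Qed.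

(** * Words whose letters up to the first one decrease *)

Definition decreasing_start w := decbelow (head 0 w) w.

(** Otherwise the letter [s] occurs after the smaller first letter, an ascent among letters at most
    [s]. *)
Lemma decbelow_head v s : ok v -> head 0 v <= s <= size v -> decbelow s v -> s = head 0 v.
Proof.
move=> ov /andP[hs sv] /decbelowP dec; apply/eqP; rewrite eqn_leq hs andbT.
rewrite leqNgt; apply/negP => lt_hs.
have : subseq [:: head 0 v; s] v.
  apply: subseq_cons_head => //; first by rewrite inE neq_ltn lt_hs.
  by rewrite sub1seq (ok_mem _ ov) sv (leq_ltn_trans _ lt_hs).
by move/dec/(_ hs (leqnn s)); rewrite ltnNge hs.
Qed.

Lemma ok1 : ok [:: 1].
Proof.
by split=> //; [apply: tight1 | move=> a b c /size_subseq | move=> a b c d /size_subseq].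
Qed.

Lemma glueable1 v s : glueable [:: 1] v s <-> ok v /\ head 0 v <= s <= size v.
Proof.
by split=> [[]//|[ov hs]]; split=> //; apply: ok1.
Qed.

Lemma glueable_gt1 u v s : 1 < size u -> glueable u v s <->
  [/\ ok u, ok v, decreasing_start v & s = head 0 v].
Proof.
move=> u1; split=> [[ou ov hs /(_ u1) dec]|[ou ov dec ->]].
  by have E := decbelow_head ov hs dec; split; rewrite // /decreasing_start -E.
split=> //; rewrite leqnn /=.
by have := mem_head0 (ok_neq0 ov); rewrite (ok_mem _ ov) => /andP[].
Qed.

(** The first letter is [s + head 0 u]. The letters up to it are those of [u] up to [head 0 u],
    raised by [s], followed by the smaller letters of [v] up to [s]; [decbelow_head] then fixes
    [s]. *)
Lemma decreasing_start_build u v s : glueable u v s ->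
  decreasing_start (build u v s) <->
  [/\ decreasing_start u, decreasing_start v & s = head 0 v].
Proof.
move=> g; have [ou ov hs _] := g; have [h_s sv] := andP hs.
have hu : head 0 u <= size u.
  by have := mem_head0 (ok_neq0 ou); rewrite (ok_mem _ ou) => /andP[].
rewrite {1}/decreasing_start head_build ?ok_neq0 //; split.
  move=> /decbelowP dec.
  have E : s = head 0 v.
    apply: decbelow_head => //; apply/decbelowP => c d scd cs ds; apply: dec; last 2 first.
    - by apply: leq_trans cs (leq_addr _ _).
    - by apply: leq_trans ds (leq_addr _ _).
    rewrite /build; apply: subseq_trans (suffix_subseq _ _).
    apply: subseq_trans (prefix_subseq _ _).
    by rewrite (_ : [:: c; d] = map (shift s (size u)) [:: c; d]) ?map_subseq //= /shift cs ds.
  split=> //.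
    apply/decbelowP => c d scd cs ds; rewrite -(ltn_add2l s); apply: dec; rewrite ?leq_add2l //.
    apply: subseq_trans (prefix_subseq _ _).
    by rewrite (_ : [:: _; _] = map (addn s) [:: c; d]) ?map_subseq.
  rewrite /decreasing_start -E; apply/decbelowP => c d scd cs ds; apply: dec; last 2 first.
  - by apply: leq_trans cs (leq_addr _ _).
  - by apply: leq_trans ds (leq_addr _ _).
  rewrite /build; apply: subseq_trans (suffix_subseq _ _).
  apply: subseq_trans (prefix_subseq _ _).
  by rewrite (_ : [:: c; d] = map (shift s (size u)) [:: c; d]) ?map_subseq //= /shift cs ds.
case=> /decbelowP du dv E; apply/decbelowP => c d.
have {}dv : decbelow s v by rewrite E.
rewrite /build catA => scd cs ds.
have {scd} [i le_i [s1 s2]] := subseq_cat_split scd.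
have n_large : s + head 0 u < (size u + size v).+1 by move: hu sv; clear; lia.
have i2 : i = 2.
  case: i le_i s1 s2 => [|[|[|//]]] _ _ //; first by rewrite drop0 => /size_subseq.
  by rewrite sub1seq inE => /eqP dn; move: ds n_large; rewrite dn; clear; lia.
move: s1; rewrite i2 {i i2 le_i s2} => /= scd.
have V_small x : x \in map (shift s (size u)) v -> x <= s + head 0 u -> x <= s.
  by case/mapP => y _ ->; rewrite /shift; case: (leqP y s) => //; move: hu; clear; lia.
have [i le_i [s1 s2]] := subseq_cat_split scd.
case: i le_i s1 s2 => [|[|[|//]]] _ /= s1 s2.
- have {}cs : c <= s by apply: V_small cs; apply: (mem_subseq s2); rewrite mem_head.
  have {}ds : d <= s by apply: V_small ds; apply: (mem_subseq s2); rewrite !inE eqxx orbT.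
  have [[|c' [|d' []]] // s2' [Ec Ed]] := subseq_map_inv s2.
  have c's : c' <= s by move: Ec cs; rewrite /shift; case: (leqP c' s) => //; clear; lia.
  have d's : d' <= s by move: Ed ds; rewrite /shift; case: (leqP d' s) => //; clear; lia.
  by rewrite Ec Ed shift_mono; apply: (decbelowP _ _ dv).
- have {}ds : d <= s by apply: V_small ds; rewrite -sub1seq.
  have /mapP[y] : c \in map (addn s) u by rewrite -sub1seq.
  by rewrite (ok_mem _ ou) => /andP[y0 _] ->; move: ds y0; clear; lia.
have [[|c' [|d' []]] // s1' [Ec Ed]] := subseq_map_inv s1.
rewrite Ec Ed ltn_add2l; apply: du => //.
  by move: cs; rewrite Ec leq_add2l.
by move: ds; rewrite Ed leq_add2l.
Qed.

Lemma ok_size1 w : ok w -> size w <= 1 -> w = [:: 1].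
Proof.
move=> ow w1; have := ok_size_pos ow; have [pw _ _ _] := ow.
case: w w1 pw {ow} => [|x []] //= _.
by move=> /perm_mem/(_ x); rewrite !inE eqxx => /esym/eqP->.
Qed.

(** First letters add up under [build] when [s = head 0 v], and so does length plus one. *)
Lemma decreasing_start_size w : ok w -> decreasing_start w ->
  (head 0 w).*2 = (size w).+1.
Proof.
have [m] := ubnP (size w); elim: m w => // m IHm w lt_wm ow dw.
have [w1|w1] := leqP (size w) 1.
  by rewrite (ok_size1 ow w1).
have [u [v [s [g E]]]] := ok_build ow w1; subst w.
have [ou ov _ _] := g; have /(decreasing_start_build g)[du dv Es] := dw.
move: lt_wm; rewrite size_build head_build ?ok_neq0 // Es doubleD => lt.
rewrite !IHm //; move: lt; clear; lia.
Qed.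

(** * Enumeration *)

Definition words k : seq (seq nat) :=
  [seq one_line p | p <- enum (uniquely_sorted_avoiding (2 * k + 1)
                                 [:: [:: 1; 3; 2]; [:: 3; 4; 1; 2]])].

Lemma mem_words k w : w \in words k <-> ok w /\ size w = 2 * k + 1.
Proof.
have n0 : 0 < 2 * k + 1 by rewrite addn1.
split=> [/mapP[p]|[[pw tw aw aw'] sw]].
  rewrite mem_enum inE /= andbT => /andP[/(uniquely_sorted_tight _ n0) t].
  case/andP=> /avoids_132 a1 /avoids_3412 a2 ->; rewrite size_one_line; split=> //.
  by split=> //; rewrite size_one_line one_line_perm.
have [p E] : exists p : 'S_(2 * k + 1), one_line p = w.
  by apply: one_line_surj; rewrite -sw.
apply/mapP; exists p; rewrite // mem_enum inE /= andbT E; apply/andP; split.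
  by apply/(uniquely_sorted_tight _ n0); rewrite E.
by apply/andP; split; [apply/avoids_132 | apply/avoids_3412].
Qed.

Lemma words_uniq k : uniq (words k).
Proof. by rewrite map_inj_uniq ?enum_uniq //; apply: one_line_inj. Qed.

Lemma size_words k : size (words k) =
  #|uniquely_sorted_avoiding (2 * k + 1) [:: [:: 1; 3; 2]; [:: 3; 4; 1; 2]]|.
Proof. by rewrite size_map -cardE. Qed.

Definition dwords k := [seq w <- words k | decreasing_start w].

Lemma mem_dwords k w : w \in dwords k <-> [/\ ok w, size w = 2 * k + 1 & decreasing_start w].
Proof.
rewrite mem_filter; split=> [/andP[dw /mem_words[ow sw]] //|[ow sw dw]].
by apply/andP; split=> //; apply/mem_words.
Qed.

Lemma ok_size w : ok w -> exists k, size w = 2 * k + 1.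
Proof. by case=> _ /tight_size-> _ _; exists (des w); rewrite mul2n addn1. Qed.

Lemma words0 : perm_eq (words 0) [:: [:: 1]].
Proof.
apply: uniq_perm; rewrite ?words_uniq // => w; rewrite inE.
apply/idP/eqP => [/mem_words[ow sw]|->]; first by apply: ok_size1; rewrite ?sw.
by apply/mem_words; split; first exact: ok1.
Qed.

Lemma dwords0 : perm_eq (dwords 0) [:: [:: 1]].
Proof. by rewrite (perm_trans (perm_filter _ words0)). Qed.

Definition glue (p : seq nat * seq nat) := build p.1 p.2 (head 0 p.2).

(** Factors of lengths 2i + 1 and 2(k - i) + 1; the index list [r] allows [i = 0] to be left out. *)
Definition pairs (A B : nat -> seq (seq nat)) (r : seq nat) k :=
  [seq p | i <- r, p <- [seq (u, v) | u <- A i, v <- B (k - i)]].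

Lemma pairsP A B r k p :
  reflect (exists i, [/\ i \in r, p.1 \in A i & p.2 \in B (k - i)]) (p \in pairs A B r k).
Proof.
apply: (iffP allpairsPdep) => [[i [q [ir /allpairsP[[u v] [ui vi ->]] ->]]]|[i [ir ui vi]]].
  by exists i.
exists i, p; split=> //; apply/allpairsP; exists p; split=> //; by case: (p).
Qed.


Lemma pairs_uniq A B r k : uniq r -> (forall i, uniq (A i)) -> (forall i, uniq (B i)) ->
  (forall i u, u \in A i -> size u = 2 * i + 1) -> uniq (pairs A B r k).
Proof.
move=> + uA uB sA; elim: r => //= i r IHr /andP[ir ur].
rewrite cat_uniq map_id IHr // andbT; apply/andP; split.
  by apply: allpairs_uniq => // -[u v] [u' v'] _ _ [-> ->].
apply/hasPn => p /pairsP[j [jr /sA pj _]]; apply/negP => /allpairsP[q [/sA qi _ E]].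
by move: pj; rewrite E /= qi => ij; move: ir; rewrite (_ : i = j) ?jr; last by lia.
Qed.

Lemma words_head k w : w \in words k -> 0 < head 0 w <= 2 * k + 1.
Proof. by case/mem_words=> ow sw; rewrite -sw -(ok_mem _ ow) mem_head0 ?ok_neq0. Qed.

Lemma dwords_head k w : w \in dwords k -> head 0 w = k.+1.
Proof. by case/mem_dwords=> ow sw dw; have := decreasing_start_size ow dw; rewrite sw; lia. Qed.

Lemma glueable_words1 k v s : v \in words k -> s \in iota (head 0 v) (2 * k + 2 - head 0 v) ->
  glueable [:: 1] v s.
Proof.
move=> vk; have := words_head vk; have /mem_words[ov sv] := vk.
rewrite mem_iota => hv hs; apply/glueable1; split=> //; rewrite sv; lia.
Qed.

Lemma glueable_words i j u v : 0 < i -> u \in words i -> v \in dwords j ->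
  glueable u v (head 0 v).
Proof.
move=> i0 /mem_words[ou su] /mem_dwords[ov _ dv].
by apply/glueable_gt1; rewrite ?su //; lia.
Qed.

Lemma glueable_dwords i j u v : u \in dwords i -> v \in dwords j ->
  glueable u v (head 0 v).
Proof.
move=> /mem_dwords[ou su du] vj; have /mem_dwords[ov sv dv] := vj.
case: (posnP i) => [i0|i_gt0]; last first.
  by apply: glueable_words i_gt0 _ vj; apply/mem_words.
rewrite (ok_size1 ou) ?su ?i0 //; apply/glueable1; split=> //; rewrite leqnn /=.
by have := mem_head0 (ok_neq0 ov); rewrite (ok_mem _ ov) => /andP[].
Qed.

(** The Catalan recurrence as a bijection: [decreasing_start] passes to both factors and determines
    [s]. *)
Lemma dwordsS k : perm_eq (dwords k.+1) (map glue (pairs dwords dwords (iota 0 k.+1) k)).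
Proof.
have gl u v : (u, v) \in pairs dwords dwords (iota 0 k.+1) k -> glueable u v (head 0 v).
  by case/pairsP=> i [_ ui vi]; apply: glueable_dwords ui vi.
apply: uniq_perm; first by rewrite filter_uniq ?words_uniq.
  rewrite map_inj_in_uniq; last first.
    by move=> [u v] [u' v'] /gl g /gl g' /(build_inj g g')[-> ->].
  apply: pairs_uniq; rewrite ?iota_uniq // => i; try by rewrite filter_uniq ?words_uniq.
  by move=> u /mem_dwords[].
move=> w; apply/idP/mapP => [/mem_dwords[ow sw dw]|[[u v] uv ->]].
  have [|u [v [s [g E]]]] := ok_build ow; first by rewrite sw; lia.
  rewrite E in dw; have [du dv Es] := (decreasing_start_build g).1 dw.
  exists (u, v); last by rewrite /glue /= -Es.
  have [ou ov _ _] := g; have [i su] := ok_size ou; have [j sv] := ok_size ov.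
  have ijk : i + j = k by move: sw; rewrite E size_build su sv; clear; lia.
  apply/pairsP; exists i; rewrite mem_iota -ijk addKn; split; first by clear; lia.
    by apply/mem_dwords.
  by apply/mem_dwords.
have g := gl _ _ uv; have ob := build_ok g.
have /pairsP[i [+ /mem_dwords[_ su du] /mem_dwords[_ sv dv]]] := uv.
rewrite mem_iota => ik; apply/mem_dwords; split; rewrite // /glue /=.
  by rewrite size_build su sv; move: ik; clear; lia.
by apply/(decreasing_start_build g).
Qed.

(** The first list has [u] a single letter and [s] free from [head 0 v] to [2 * k + 1]; the second
    has a longer [u], where [s] is forced and [v] has a decreasing start. *)
Lemma wordsS k : perm_eq (words k.+1)
  ([seq build [:: 1] v s | v <- words k, s <- iota (head 0 v) (2 * k + 2 - head 0 v)] ++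
   map glue (pairs words dwords (iota 1 k) k)).
Proof.
have gl u v : (u, v) \in pairs words dwords (iota 1 k) k ->
    1 < size u /\ glueable u v (head 0 v).
  case/pairsP=> i [+ ui vi]; rewrite mem_iota => /andP[i0 _].
  split; last exact: glueable_words ui vi.
  by have /mem_words[_ /= ->] := ui; move: i0; clear; lia.
apply: uniq_perm; first exact: words_uniq.
  rewrite cat_uniq; apply/and3P; split.
  - apply: allpairs_uniq_dep => [|v _|]; rewrite ?words_uniq ?iota_uniq //.
    move=> [v s] [v' s'] /allpairsPdep[a [b [ak bk E]]] /allpairsPdep[a' [b' [ak' bk' E']]].
    have [Ev Es] : v = a /\ s = b by case: E.
    have [Ev' Es'] : v' = a' /\ s' = b' by case: E'.
    subst a b a' b' => /=.
    by move/(build_inj (glueable_words1 ak bk) (glueable_words1 ak' bk'))=> [_ -> ->].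
  - apply/hasPn => w /mapP[[u v] /gl[u1 g] ->]; apply/negP.
    case/allpairsPdep=> v' [s [v'k sk /(build_inj g (glueable_words1 v'k sk))[Eu _ _]]].
    by rewrite Eu in u1.
  rewrite map_inj_in_uniq; last first.
    by move=> [u v] [u' v'] /gl[_ g] /gl[_ g'] /(build_inj g g')[-> ->].
  apply: pairs_uniq; rewrite ?iota_uniq // => i; try by rewrite ?filter_uniq ?words_uniq.
  by move=> u /mem_words[].
move=> w; rewrite mem_cat; apply/idP/orP => [/mem_words[ow sw]|].
  have [|u [v [s [g E]]]] := ok_build ow; first by rewrite sw; lia.
  have [ou ov hs _] := g; have [i su] := ok_size ou; have [j sv] := ok_size ov.
  have ijk : i + j = k by move: sw; rewrite E size_build su sv; clear; lia.
  case: (posnP i) => [i0|i_gt0]; [left | right].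
    have Eu : u = [:: 1] by apply: ok_size1; rewrite ?su ?i0.
    apply/allpairsPdep; exists v, s; rewrite E Eu; split=> //.
      by apply/mem_words; rewrite sv -ijk i0.
    by rewrite mem_iota; move: hs; rewrite sv -ijk i0; clear; lia.
  have u1 : 1 < size u by rewrite su; move: i_gt0; clear; lia.
  have [_ _ dv Es] := (glueable_gt1 v s u1).1 g.
  apply/mapP; exists (u, v); last by rewrite E /glue /= -Es.
  apply/pairsP; exists i; rewrite mem_iota -ijk addKn; split.
  - by move: i_gt0; clear; lia.
  - exact/mem_words.
  exact/mem_dwords.
case=> [/allpairsPdep[v [s [vk sk ->]]]|/mapP[[u v] uv ->]]; apply/mem_words.
  split; first exact/build_ok/(glueable_words1 vk sk).
  by have /mem_words[_ sv] := vk; rewrite size_build sv; clear; rewrite /=; lia.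
have [u1 g] := gl _ _ uv; split; first exact: build_ok.
have /pairsP[i [+ /mem_words[_ su] /mem_dwords[_ sv _]]] := uv.
by rewrite mem_iota size_build su sv; clear; lia.
Qed.

(** * Generating functions *)

Lemma size_pairs A B r k :
  size (pairs A B r k) = \sum_(i <- r) size (A i) * size (B (k - i)).
Proof.
rewrite size_flatten /shape -map_comp sumnE big_map; apply: eq_bigr => i _ /=.
by rewrite size_map size_allpairs.
Qed.

Lemma size_dwords0 : size (dwords 0) = 1.
Proof. by rewrite (perm_size dwords0). Qed.

Lemma size_dwordsS k :
  size (dwords k.+1) = \sum_(i < k.+1) size (dwords i) * size (dwords (k - i)).
Proof. by rewrite (perm_size (dwordsS k)) size_map size_pairs -/(index_iota 0 k.+1) big_mkord. Qed.

Local Open Scope ring_scope.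
Import GRing.Theory Num.Theory.

Lemma sum_allpairs (V : nmodType) (I J K : Type) (f : I -> J -> K) (r : seq I) (t : I -> seq J)
    (F : K -> V) :
  \sum_(z <- [seq f i j | i <- r, j <- t i]) F z = \sum_(i <- r) \sum_(j <- t i) F (f i j).
Proof. exact: big_allpairs_dep. Qed.

(** * The functional equation, coefficient by coefficient *)

Section HeadSeries.
Variable R : comNzRingType.
Implicit Type z : R.

(** The coefficient of x^k in A(x, z). *)
Definition headgf k z : R := \sum_(w <- words k) z ^+ ((2 * k).+1 - head 0%N w).

Lemma headgf0 z : headgf 0 z = 1.
Proof. by rewrite /headgf (perm_big _ words0) big_seq1. Qed.

Lemma headgf1 k : headgf k 1 = (size (words k))%:R.
Proof.
rewrite /headgf (eq_bigr (fun=> 1)) => [|w _]; last by rewrite expr1n.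
by rewrite big_const_seq count_predT iter_addr addr0.
Qed.

Lemma geometric_iota z h m :
  (1 - z) * \sum_(s <- iota h m) z ^+ (h + m - s) = z - z ^+ m.+1.
Proof.
elim: m h => [|m IHm] h; first by rewrite big_nil mulr0 expr1 subrr.
rewrite [iota _ _]/= big_cons addKn -addSnnS mulrDr IHm !exprS; ring.
Qed.

Lemma headgfS k z :
  (1 - z) * headgf k.+1 z = z * (headgf k 1 - z * headgf k z) +
    (1 - z) * z * \sum_(i <- iota 1 k) headgf i z * ((size (dwords (k - i)))%:R * z ^+ (k - i)).
Proof.
rewrite /headgf (perm_big _ (wordsS k)) big_cat mulrDr; congr (_ + _).
  rewrite sum_allpairs [z * \sum_(_ <- _) _]mulr_sumr -sumrB !mulr_sumr.
  apply: eq_big_seq => v /words_head hv.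
  (* The glued word has length [2 * k + 3] and first letter [s + 1]; its exponent [2 * k + 2 - s] is
     put into the shape of [geometric_iota]. *)
  rewrite expr1n (eq_big_seq (fun s => z ^+ (head 0%N v + (2 * k + 2 - head 0%N v) - s))).
    rewrite geometric_iota mulrBr mulr1 mulrA -expr2 -exprD; congr (_ - z ^+ _).
    by move: hv; clear; lia.
  move=> s _; congr (z ^+ _); rewrite head_build //=.
  by move: hv; clear; lia.
rewrite -mulrA; congr (_ * _); rewrite big_map sum_allpairs mulr_sumr.
apply: eq_big_seq => i; rewrite mem_iota => ik.
rewrite sum_allpairs mulr_suml mulr_sumr; apply: eq_big_seq => u ui.
(* Exponents add: 1 for the new maximum, the exponent of [u], and [k - i] for [v], whose first
   letter is [k - i + 1]. *)
rewrite (eq_big_seq (fun=> z * (z ^+ ((2 * i).+1 - head 0%N u) * z ^+ (k - i)))).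
  rewrite big_const_seq count_predT iter_addr addr0 -mulr_natl; ring.
move=> v vki; rewrite -exprD -exprS; congr (z ^+ _).
have [ou _] := (mem_words i u).1 ui; have := words_head ui; have := dwords_head vki.
by rewrite /glue head_build ?ok_neq0 //; move: ik; clear; rewrite /=; lia.
Qed.
End HeadSeries.

(** * Power series modulo [x ^+ N] *)

Section TruncatedSeries.
Variable R : comNzRingType.
Variables (x : R) (N : nat).

(** The product is taken in the polynomial ring, cut at degree [N], and evaluated at [x]. *)
Lemma convolution (a b : nat -> R) : exists r,
  \sum_(k < N) (\sum_(i < k.+1) a i * b (k - i)%N) * x ^+ k =
  (\sum_(k < N) a k * x ^+ k) * (\sum_(k < N) b k * x ^+ k) + x ^+ N * r.
Proof.
pose p := \poly_(i < N) a i; pose q := \poly_(i < N) b i.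
exists (- (drop_poly N (p * q)).[x]).
have := congr1 (fun f => f.[x]) (poly_take_drop N (p * q)).
rewrite hornerD hornerM hornerXn hornerM !horner_poly => <-.
rewrite mulrN [x ^+ N * _]mulrC addrK; apply: eq_bigr => k _; congr (_ * _).
rewrite coefM; apply: eq_bigr => i _; rewrite !coef_poly.
by rewrite (leq_ltn_trans _ (ltn_ord k)) ?(leq_ltn_trans (leq_subr _ _)) // -ltnS.
Qed.

(** Substituting the equation into itself [N] times puts a factor [x ^+ N] on every term. *)
Lemma contraction (d e q : R) : d = x * e * d + x ^+ N * q -> exists q', d = x ^+ N * q'.
Proof.
move=> E; suff [q' Eq'] : exists q', d = (x * e) ^+ N * d + x ^+ N * q'.
  by exists (e ^+ N * d + q'); rewrite {1}Eq' exprMn; ring.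
elim: {1}N => [|i [q' IHi]]; first by exists 0; rewrite expr0; ring.
exists ((x * e) ^+ i * q + q'); rewrite {1}IHi {1}E exprSr; ring.
Qed.

(** Replacing [T] by [1 + x * T ^+ 3] gains one power of [x], since the difference of the cubes is
    divisible by [T' - T]. *)
Lemma ternary_series : exists T r, T = 1 + x * T ^+ 3 + x ^+ N * r :> R.
Proof.
elim: N => [|n [T [r E]]]; first by exists 0, (- 1); rewrite expr0; ring.
pose T' := 1 + x * T ^+ 3; exists T', (- (r * - 1 * (T' ^+ 2 + T' * T + T ^+ 2))).
have E' : T' - T = - (x ^+ n * r) by rewrite {1}E -/T'; ring.
rewrite {1}/T' [x ^+ n.+1]exprS.
have -> : T ^+ 3 = T' ^+ 3 - (T' - T) * (T' ^+ 2 + T' * T + T ^+ 2) by ring.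
rewrite E'; ring.
Qed.
End TruncatedSeries.

(** * The kernel method at y = T *)

Section Kernel.
Variables (R : comNzRingType) (x T r0 : R) (N : nat).
Hypothesis ET : T = 1 + x * T ^+ 3 + x ^+ N * r0.

Let A := \sum_(k < N) headgf k T * x ^+ k.
Let B := \sum_(k < N) headgf k 1 * x ^+ k.
Let C := \sum_(k < N) ((size (dwords k))%:R * T ^+ k) * x ^+ k.

Lemma sum_shift (f : nat -> R) :
  x * (\sum_(k < N) f k.+1 * x ^+ k) = \sum_(k < N) f k * x ^+ k + f N * x ^+ N - f 0%N.
Proof.
have := big_ord_recr N (fun k : 'I_N.+1 => f k * x ^+ k) : _ = _ + _; rewrite /= => <-.
rewrite big_ord_recl /= expr0 mulr1 [f 0%N + _]addrC addrK.
by rewrite mulr_sumr; apply: eq_bigr => i _; rewrite exprS; ring.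
Qed.

(** Modulo [x ^+ N] both [C] and [T] solve Y = 1 + x T Y^2, so [C - T] equals [x * (T * (C + T))]
    times itself, and [contraction] applies. *)
Lemma catalan_series : exists q, C = T + x ^+ N * q.
Proof.
pose c k := (size (dwords k))%:R * T ^+ k : R.
have [r1 E1] := convolution x N c c.
have E2 : \sum_(k < N) c k.+1 * x ^+ k = T * (C * C + x ^+ N * r1).
  rewrite -E1 mulr_sumr; apply: eq_bigr => k _; rewrite mulrA; congr (_ * _).
  rewrite {1}/c size_dwordsS natr_sum mulr_suml mulr_sumr; apply: eq_bigr => i _.
  have ik : (i <= k)%N by rewrite -ltnS.
  rewrite /c natrM exprS (_ : T ^+ k = T ^+ i * T ^+ (k - i)%N); first by ring.
  by rewrite -exprD subnKC.
have := sum_shift c; rewrite E2 -/C {2}/c size_dwords0 expr0 mulr1 => E3.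
have [q Eq] : exists q, C - T = x ^+ N * q.
  apply: (@contraction _ x N _ (T * (C + T)) (x * T * r1 - c N - r0)).
  have EC : C = x * (T * (C * C + x ^+ N * r1)) - c N * x ^+ N + 1 by rewrite E3; ring.
  by rewrite {1}ET {1}EC; ring.
by exists q; rewrite -Eq; ring.
Qed.

Lemma head_series : exists q,
  (1 - T) * (A - 1) = x * T * (B - T * A) + (1 - T) * x * T ^+ 2 * (A - 1) + x ^+ N * q.
Proof.
pose c k := (size (dwords k))%:R * T ^+ k : R.
have [r1 E1] := convolution x N (fun k => headgf k T) c.
have [q EC] := catalan_series.
have := sum_shift (fun k => headgf k T); rewrite -/A headgf0 => E2.
have E3 : (1 - T) * (\sum_(k < N) headgf k.+1 T * x ^+ k) =
    T * (B - T * A) + (1 - T) * T * (A * C + x ^+ N * r1 - C).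
  rewrite -E1 -sumrB [T * A]mulr_sumr -sumrB !mulr_sumr -big_split /=; apply: eq_bigr => k _.
  rewrite [X in X = _]mulrA headgfS mulrDl; congr (_ + _); first by ring.
  rewrite -mulrA; congr (_ * _); rewrite -mulrBl; congr (_ * _).
  (* The sum in [headgfS] starts at [i = 1]; the term [i = 0] of the convolution is the Catalan
     coefficient that is subtracted. *)
  rewrite big_ord_recl headgf0 mul1r subn0 addrC addKr.
  rewrite (_ : iota 1 k = map S (index_iota 0 k)) ?big_map ?big_mkord //.
  by rewrite /index_iota subn0 (iotaDl 1 0 k).
exists ((1 - T) * x * T * (A * q + r1 - q) - (1 - T) * headgf N T).
have -> : (1 - T) * (A - 1) =
    x * ((1 - T) * (\sum_(k < N) headgf k.+1 T * x ^+ k)) - (1 - T) * (headgf N T * x ^+ N).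
  by rewrite mulrCA E2; ring.
rewrite E3 EC; ring.
Qed.

(** Modulo [x ^+ N] one has T(1 - x T^2) = 1 and x T^3 = T - 1. Multiplying [head_series] by [T]
    therefore cancels [A] and leaves x T^2 (B - T) = 0, where T^2 is invertible. *)
Lemma kernel_series : exists q, x * (B - T) = x ^+ N * q.
Proof.
have [r1 E1] := head_series; have E2 := ET; set w := x ^+ N in E1 E2 *.
pose K := A - (1 - T) * (A - 1); pose r4 := r0 - r0 * K - T * r1.
have E3 : x * T ^+ 2 * (B - T) = w * r4.
  pose D1 := T * ((1 - T) * (A - 1) -
    (x * T * (B - T * A) + (1 - T) * x * T ^+ 2 * (A - 1) + w * r1)).
  pose D2 := T - (1 + x * T ^+ 3 + w * r0).
  have D10 : D1 = 0 by rewrite /D1 E1 subrr mulr0.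
  have D20 : D2 = 0 by rewrite /D2 {1}E2 subrr.
  suff -> : x * T ^+ 2 * (B - T) = w * r4 + D2 * (1 - K) - D1.
    by rewrite D10 D20; ring.
  rewrite /D1 /D2 /r4 /K; ring.
(* An inverse of [T] modulo [x ^+ N]; the witness below comes from expanding (1 + w r0)^2. *)
have E4 : T * (1 - x * T ^+ 2) = 1 + w * r0 by rewrite mulrBr {1}E2; ring.
exists ((1 - x * T ^+ 2) ^+ 2 * r4 - x * (B - T) * (r0 *+ 2 + w * r0 ^+ 2)).
suff E5 : x * (B - T) * (1 + w * r0) ^+ 2 = (1 - x * T ^+ 2) ^+ 2 * (w * r4).
  transitivity (x * (B - T) * (1 + w * r0) ^+ 2 - w * (x * (B - T) * (r0 *+ 2 + w * r0 ^+ 2))).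
    by ring.
  by rewrite E5; ring.
rewrite -E3 -E4; ring.
Qed.
End Kernel.

(* The coefficient of [x ^ m] in [T ^ r], where [T = 1 + x T ^ 3]; the case [m = 0] is apart
   because the quotient is [0 / 0 = 0] for [r = m = 0]. *)
Definition raney r m : rat :=
  if m is 0 then 1 else r%:R / (3 * m + r)%:R * 'C(3 * m + r, m)%:R.

(** This is T^(r+1) = T^r + x T^(r+3) read off at x^(m+1). All binomials are reduced to ['C(n, m)]
    with n = 3m + r + 3. *)
Lemma raney_rec r m : raney r.+1 m.+1 = raney r m.+1 + raney r.+3 m.
Proof.
have E : raney r.+3 m = r.+3%:R / (3 * m + r.+3)%:R * 'C(3 * m + r.+3, m)%:R.
  by case: m => // ; rewrite bin0 mulr1 divff // pnatr_eq0.
rewrite E /raney; set n := (3 * m + r.+3)%N.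
have -> : (3 * m.+1 + r.+1 = n.+1)%N by rewrite /n; lia.
have -> : (3 * m.+1 + r = n)%N by rewrite /n; lia.
have E1 := congr1 (fun i => i%:R : rat) (mul_bin_diag n.+1 m).
have E2 := congr1 (fun i => i%:R : rat) (mul_bin_left n m).
move: E1 E2; rewrite /= !natrM natrB; last by rewrite /n; lia.
move=> E1 E2; have n0 : n%:R != 0 :> rat by rewrite pnatr_eq0 /n; lia.
have n1 : n.+1%:R != 0 :> rat by rewrite pnatr_eq0.
have m1 : m.+1%:R != 0 :> rat by rewrite pnatr_eq0.
have -> : 'C(n.+1, m.+1)%:R = n.+1%:R * 'C(n, m)%:R / m.+1%:R :> rat.
  by rewrite E1 mulrC mulKf.
have -> : 'C(n, m.+1)%:R = (n%:R - m%:R) * 'C(n, m)%:R / m.+1%:R :> rat.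
  by rewrite -E2 mulrC mulKf.
have En : n%:R = 3 * m%:R + r%:R + 3 :> rat by rewrite /n -[r.+3]addn3 addnA 2!natrD natrM.
move: n0 n1 m1; rewrite -![_.+1%:R]natr1 En => n0 n1 m1.
by field; rewrite n0 n1 m1.
Qed.

(** Induction on [m], then on [r]: the coefficients obey the recurrence [raney_rec] with the same
    initial values. *)
Lemma coef_ternary (T q : {poly rat}) N : T = 1 + 'X * T ^+ 3 + 'X^N * q ->
  forall m r, (m < N)%N -> (T ^+ r)`_m = raney r m.
Proof.
move=> ET; have T0 : (0 < N)%N -> T`_0 = 1.
  move=> N0; rewrite ET !coefD coefXM coefXnM N0 coef1 /=; ring.
elim=> [|m IHm] r lt_mN.
  by elim: r => [|r IHr]; rewrite ?expr0 ?coef1 // exprS coef0M IHr T0 // mulr1.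
elim: r => [|r IHr]; first by rewrite expr0 coef1 /raney mul0r mul0r.
have -> : T ^+ r.+1 = T ^+ r + 'X * T ^+ r.+3 + 'X^N * (q * T ^+ r).
  by rewrite exprS {1}ET !exprS; ring.
by rewrite !coefD coefXM coefXnM lt_mN /= addr0 IHr IHm ?(ltnW lt_mN) // -raney_rec.
Qed.

Lemma size_words_raney k : (size (words k))%:R = raney 1 k.
Proof.
(* [kernel_series] carries an extra factor [x], so coefficient [k] is read at degree [k + 1], below
   the precision [k + 2]. *)
have [T [r ET]] := ternary_series ('X : {poly rat}) k.+2.
have [q Eq] := kernel_series ET.
rewrite -(coef_ternary ET 1) // expr1.
have := congr1 (fun p : {poly rat} => p`_k.+1) Eq.
rewrite coefXM coefXnM ltnSn /= coefB => /eqP; rewrite subr_eq0 => /eqP <-.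
rewrite (eq_bigr (fun i : 'I_k.+2 => (size (words i))%:R%:P * 'X^i)) => [|i _]; last first.
  by rewrite headgf1 polyC_natr.
under eq_bigr do rewrite mul_polyC.
by rewrite -(poly_def k.+2 (fun i => (size (words i))%:R)) coef_poly leqnSn.
Qed.

Theorem theorem5p7 (k : nat) :
  (#|uniquely_sorted_avoiding (2 * k + 1) [:: [:: 1; 3; 2]; [:: 3; 4; 1; 2]]%N|%:R
    = 1 / (2 * k + 1)%N%:R * 'C(3 * k, k)%:R :> rat)%R.
Proof.
rewrite -size_words size_words_raney.
case: k => [|k]; first by rewrite bin0 mulr1 divr1.
rewrite /raney; set m := k.+1; clearbody m.
(* This is (3m + 1) C(3m, m) = (2m + 1) C(3m + 1, m), which turns the Raney form into the stated
   one. *)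
have := congr1 (fun i => i%:R : rat) (mul_bin_down (3 * m + 1) m).
rewrite !natrM (_ : 3 * m + 1 - m = 2 * m + 1)%N; last by lia.
have n0 : (3 * m + 1)%:R != 0 :> rat by rewrite pnatr_eq0 addn1.
have m0 : (2 * m + 1)%:R != 0 :> rat by rewrite pnatr_eq0 addn1.
move=> E; apply: (mulfI n0); apply: (mulfI m0).
rewrite !mul1r mulVKf // -E [RHS]mulrCA mulVKf //.
by rewrite addn1.
Qed.
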